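(* Let $w=(w_1,w_2)$ be a pair of positive integers with $w_2>w_1$, let $U\subset\mathbb{C}$ be a domain, and let $F(x,y,t)$ be a complex polynomial function such that for each $t\in U$ the function $f_t(x,y)=F(x,y,t)$ is $w$-homogeneous with an isolated singularity at $(0,0)\in\mathbb{C}^2$. If $\{f_t : t\in U\}$, as a family of function-germs at $(0,0)\in\mathbb{C}^2$, is strongly bi-Lipschitz trivial, then $f_{t_1}$ is analytically equivalent to $f_{t_2}$ for any $t_1,t_2\in U$.
   Context: Weighted homogeneity: for $w=(w_1,\dots,w_n)$ an $n$-tuple of positive integers, a polynomial $f(x_1,\dots,x_n)$ is $w$-homogeneous of degree $d$ if $f(s^{w_1}x_1,\dots,s^{w_n}x_n)=s^d f(x_1,\dots,x_n)$ for all $s\in\mathbb{C}^*$. Analytic equivalence: two function-germs $f,g\colon(\mathbb{C}^n,0)\to(\mathbb{C},0)$ are analytically equivalent if there exists a germ of bi-analytic map $\phi\colon(\mathbb{C}^n,0)\to(\mathbb{C}^n,0)$ such that $f=g\circ\phi$. Strong bi-Lipschitz triviality: let $f_t$ ($t\in U$, $U$ a domain in $\mathbb{C}$) be a family of analytic function-germs, i.e. there are a neighborhood $W$ of $0$ in $\mathbb{C}^n$ and an analytic function $F\colon W\times U\to\mathbb{C}$ with $F(0,t)=0$ and $f_t(x)=F(x,t)$ for all $t\in U$, $x\in W$. The family $f_t$ is strongly bi-Lipschitz trivial if there is a continuous family of Lipschitz vector fields $v_t\colon\mathbb{C}^n\to\mathbb{C}^n$ such that $\frac{\partial f_t}{\partial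 t}(x)=(df_t)(x)(v_t(x))$ for all $t\in U$ and all $x\in W$. *)

(* Defs.v *)
From HB Require Import structures.
From mathcomp Require Import all_boot all_order all_algebra.
From mathcomp Require Import all_classical all_reals all_analysis.
From mathcomp Require Import complex.
(* Not imported: mpoly clashes with the notations above, summability rebinds [sum]. *)
From mathcomp Require mpoly.
From mathcomp.analysis.showcase Require summability.

Set Implicit Arguments.
Unset Strict Implicit.
Unset Printing Implicit Defensive.

Import Order.TTheory GRing.Theory Num.Theory.
Import numFieldNormedType.Exports.

Local Open Scope classical_set_scope.
Local Open Scope ring_scope.

(* The definitions are stated over a numFieldType [K] and are meant for
   [K := R[i]] with [R : realType]; the topology is that of the modulus, and
   ['rV[K]_n] carries the sup norm. A germ at [0] is represented by a total
   function, of which only the values near [0] are constrained. *)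

(* Convergence is along the finite sets of multi-indices, hence unconditional,
   that is, absolute. *)
Definition has_power_series_sum (K : numFieldType) n
    (c : {ffun 'I_n -> nat} -> K) (h : 'rV[K]_n) (s : K) :=
  summability.partial_sum
    (fun m : {ffun 'I_n -> nat} => c m * \prod_(i < n) h ord0 i ^+ m i)
    @ summability.totally --> s.

Definition analytic_at (K : numFieldType) n (f : 'rV[K]_n -> K) (a : 'rV[K]_n) :=
  exists c : {ffun 'I_n -> nat} -> K,
    \forall x \near a, has_power_series_sum c (x - a) (f x).

Definition analytic_map_at (K : numFieldType) m n (f : 'rV[K]_m -> 'rV[K]_n)
    (a : 'rV[K]_m) :=
  forall j, analytic_at (fun x => f x ord0 j) a.

Definition bianalytic_germ (K : numFieldType) n (phi : 'rV[K]_n -> 'rV[K]_n) :=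
  [/\ phi 0 = 0, analytic_map_at phi 0 &
    exists psi : 'rV[K]_n -> 'rV[K]_n,
      [/\ psi 0 = 0, analytic_map_at psi 0,
          \forall x \near (0 : 'rV[K]_n), psi (phi x) = x &
          \forall y \near (0 : 'rV[K]_n), phi (psi y) = y]].

Definition analytically_equivalent (K : numFieldType) n (f g : 'rV[K]_n -> K) :=
  exists2 phi : 'rV[K]_n -> 'rV[K]_n, bianalytic_germ phi &
    \forall x \near (0 : 'rV[K]_n), f x = g (phi x).

Definition w_homogeneous (K : numFieldType) n (w : 'I_n -> nat) (d : nat)
    (f : 'rV[K]_n -> K) :=
  forall s : K, s != 0 -> forall x : 'rV[K]_n,
    f (\row_i (s ^+ w i * x ord0 i)) = s ^+ d * f x.

(* ['d f x] is meaningful only where [f] is differentiable; this is used for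
   polynomial functions only. *)
Definition singular_at (K : numFieldType) n (f : 'rV[K]_n -> K) (x : 'rV[K]_n) :=
  forall h : 'rV[K]_n, 'd f x h = 0.

Definition isolated_singularity (K : numFieldType) n (f : 'rV[K]_n -> K)
    (a : 'rV[K]_n) :=
  singular_at f a /\ \forall x \near a^', ~ singular_at f x.

Definition domain (K : numFieldType) (U : set K) :=
  [/\ open U, connected U & U !=set0].

(* A function on [K^n * K] is a function of [n + 1] variables, the parameter
   [t] being the last one; [member F t] is f_t. *)
Definition member (K : numFieldType) n (F : 'rV[K]_(n + 1) -> K) (t : K)
    (x : 'rV[K]_n) : K :=
  F (row_mx x (const_mx t)).

Definition analytic_family (K : numFieldType) n (W : set 'rV[K]_n) (U : set K)
    (F : 'rV[K]_(n + 1) -> K) :=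
  (forall x t, W x -> U t -> analytic_at F (row_mx x (const_mx t))) /\
  (forall t, U t -> member F t 0 = 0).

(* The continuity of the family [v] is joint in [(t, x)]; the Lipschitz
   constant of [v t] may depend on [t]. *)
Definition strongly_biLipschitz_trivial (K : numFieldType) n (U : set K)
    (F : 'rV[K]_(n + 1) -> K) :=
  exists W : set 'rV[K]_n, [/\ open_nbhs (0 : 'rV[K]_n) W, analytic_family W U F &
    exists v : K -> 'rV[K]_n -> 'rV[K]_n,
      [/\ {within U `*` [set: 'rV[K]_n],
             continuous (fun p : K * 'rV[K]_n => v p.1 p.2)},
          forall t, U t -> lipschitz (v t) &
          forall t x, U t -> W x ->
            derive1 (fun s : K => member F s x) t = 'd (member F t) x (v t x)]].

Definition polynomial_function (K : numFieldType) n (F : 'rV[K]_n -> K) :=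
  exists P : mpoly.mpoly n K, forall x, F x = mpoly.meval (x ord0) P.

(* Main.v *)
Require Import Defs.
From HB Require Import structures.
From mathcomp Require Import all_boot all_order all_algebra.
From mathcomp Require Import all_classical all_reals all_analysis.
From mathcomp Require Import complex finmap ring zify.

Set Implicit Arguments.
Unset Strict Implicit.
Unset Printing Implicit Defensive.

Import Order.TTheory GRing.Theory Num.Theory.
Import numFieldNormedType.Exports.

Local Open Scope classical_set_scope.
Local Open Scope ring_scope.

(** Why the theorem is true. Write (w0, w1) for the weights. Grading by weight
    shows that the degree d is the same for all t in U and that
      f_t(x, y) = sum_(j <= m) a_j(t) x^(I j) y^j  with  w0 * I j + w1 * j = d,
    where a_m vanishes nowhere on U: a reduced weighted homogeneous germ has a
    monomial with exponent at most 1 in x, and w0 < w1 leaves only one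
    candidate for it ([weighted_normal_form]). So f_t is encoded by the
    one-variable polynomial F_t(z) = f_t(1, z), through
      f_t(s^w0, z s^w1) = s^d F_t(z),
    and F_t has simple roots because the singularity is isolated.

    Let v = (v0, v1) be the Lipschitz field at t, and let G be the derivative
    of F_t in t. Euler's relation turns the equation df_t/dt = df_t(v) on the
    curves z = const into
      w0 G(z) = (d F(z) - w1 z F'(z)) V0 + w0 F'(z) V1,
    with V0 = v0 / s^w0 and V1 = v1 / s^w1. When z changes by h at fixed s the
    point moves by h s^w1 only, so V1 is L-Lipschitz in z, while V0 is
    L |s|^(w1 - w0)-Lipschitz, hence asymptotically independent of z since
    w0 < w1. At a critical point of F the equation determines V0, so V0 tends
    to a constant A1; letting s tend to 0 shows that
    (w0 G - d A1 F) / F' is a Lipschitz function of z where F' does not vanish,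
    hence a polynomial of degree at most 1 ([dvdp_of_bound],
    [lipschitz_flow]). Therefore, for some A, alpha and beta depending on t,
      dF_t/dt = A F_t + (alpha z + beta) F_t' :
    the family is infinitesimally tangent to the orbits of the affine group.

    This is integrated algebraically ([affine_rigidity]). After a translation
    that kills the subleading coefficient, and after clearing denominators, the
    coefficients E_k(t) are polynomials in t satisfying E_k' = k eta E_k on U
    with a common eta. Two products of E_k's of equal weight are then
    proportional ([wronskian_proportional]), so the ratios E_k(t1) / E_k(t2)
    define a homomorphism from a subgroup of the integers to the nonzero
    scalars; it extends to all integers, and E_k(t1) = lam^k E_k(t2) for one
    lam ([weighted_scaling]). Hence F_t1 is F_t2 composed with an affine map,
    up to a constant factor. That affine map is realized on the plane by
    (x, y) |-> (mu x, be y + ga x^(w1/w0)), which makes sense because ga <> 0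
    forces w0 to divide w1 ([graded_sum_triangular]). *)

(** * Algebraically closed fields and scaling invariants *)

Lemma coefM_top (K : idomainType) (p q : {poly K}) i j :
  (size p <= i.+1)%N -> (size q <= j.+1)%N -> (p * q)`_(i + j) = p`_i * q`_j.
Proof.
move=> sp sq; rewrite coefM (bigD1 (inord i)) //= inordK ?ltnS ?leq_addr //.
rewrite addKn big1 ?addr0 // => k /eqP neq_ki.
have [lt_ik|le_ki] := ltnP i k; first by rewrite nth_default ?mul0r ?(leq_trans sp).
rewrite [q`__]nth_default ?mulr0 // (leq_trans sq) //.
have: k != i :> nat by apply/eqP => /(congr1 (@inord (i + j))); rewrite inord_val.
by move: le_ki; lia.
Qed.

(** In characteristic 0 the operator X d/dX multiplies the leading coefficient
    by the degree, so comparing top coefficients in p' q = p q' gives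
    deg p = deg q. *)
Lemma wronskian_eq_size (K : numFieldType) (p q : {poly K}) :
  p != 0 -> q != 0 -> p^`() * q = p * q^`() -> size p = size q.
Proof.
move=> p0 q0 wpq.
have sX (r : {poly K}) : r != 0 -> (size (r^`() * 'X)%R <= (size r).-1.+1)%N.
  move=> r0; have [->|r'0] := eqVneq r^`() 0; first by rewrite mul0r size_poly0.
  by rewrite size_mulX // prednK ?size_poly_gt0 // lt_size_deriv.
have cX (r : {poly K}) : (r^`() * 'X)`_(size r).-1 = lead_coef r *+ (size r).-1.
  by rewrite coefMX lead_coefE; case: (size r).-1 => [|k]; rewrite ?mulr0n ?coef_deriv.
have sr (r : {poly K}) : (size r <= (size r).-1.+1)%N by case: (size r).
have /(congr1 (fun r : {poly K} => r`_((size p).-1 + (size q).-1))) :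
    (p^`() * 'X) * q = p * (q^`() * 'X) by rewrite mulrAC wpq mulrA.
rewrite !coefM_top ?sX ?sr // !cX -[q`__]lead_coefE -[p`__]lead_coefE mulrnAl mulrnAr.
move/mulrIn; rewrite mulf_eq0 !lead_coef_eq0 negb_or p0 q0 => /(_ isT) epq.
by rewrite -[size p]prednK ?size_poly_gt0 // epq prednK ?size_poly_gt0.
Qed.

(** With C the quotient of the leading coefficients, r = p - C q satisfies the
    same relation and has smaller degree than q, so it must vanish. *)
Lemma wronskian_proportional (K : numFieldType) (p q : {poly K}) :
  q != 0 -> p^`() * q = p * q^`() -> exists C, p = C *: q.
Proof.
move=> q0 wpq; have [->|p0] := eqVneq p 0; first by exists 0; rewrite scale0r.
have spq := wronskian_eq_size p0 q0 wpq.
exists (lead_coef p / lead_coef q); apply/eqP; rewrite -subr_eq0; apply/negPn/negP.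
set r := p - _ => r0.
have /(wronskian_eq_size r0 q0) srq : r^`() * q = r * q^`().
  by rewrite derivB derivZ mulrBl wpq mulrBl -!scalerAl [q^`() * q]mulrC.
have : (size r <= (size q).-1)%N.
  apply/leq_sizeP => j; rewrite leq_eqVlt => /predU1P[<-|le_qj].
    rewrite coefB coefZ -[q`__]lead_coefE -{1}spq -lead_coefE.
    by rewrite divfK ?subrr // lead_coef_eq0.
  rewrite !(coefB, coefZ) !nth_default ?mulr0 ?subr0 ?spq //; first by case: (size q) le_qj.
  by case: (size q) le_qj.
by rewrite srq leqNgt prednK ?size_poly_gt0 // leqnn.
Qed.

(** Stated as a hypothesis on a field, so that the field keeps a single
    topology: the one that comes with its modulus. *)
Definition alg_closed (K : fieldType) :=
  forall p : {poly K}, size p != 1 -> exists x, root p x.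

Lemma exists_rootn (K : fieldType) n (x : K) :
  alg_closed K -> (0 < n)%N -> exists y, y ^+ n = x.
Proof.
move=> K_closed n_gt0; have [|y] := K_closed ('X^n - x%:P).
  by rewrite size_XnsubC // eqSS -lt0n.
by rewrite rootE !hornerE subr_eq0 => /eqP <-; exists y.
Qed.

Section WeightedScaling.
Variables (K : numFieldType) (U : set K) (eta : K -> K) (t1 t2 : K).
Hypothesis U_dense : forall p : {poly K}, (forall t, U t -> p.[t] = 0) -> p = 0.
Hypothesis K_closed : alg_closed K.

(** The logarithmic derivative of P / Q is n * eta on U; the denominators are
    cleared. *)
Definition isobaric n (P Q : {poly K}) := forall t, U t ->
  (P^`()).[t] * Q.[t] - P.[t] * (Q^`()).[t] = n%:R * eta t * (P.[t] * Q.[t]).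

(** Pairs (n, x) where x is the ratio between the values at t1 and t2 of a
    rational function of weight n. They form the graph of a homomorphism from
    a group of integers to the nonzero scalars, [transport0] being the fact
    that the graph is single-valued. *)
Definition transport n (x : K) := exists P Q : {poly K},
  [/\ P.[t1] * P.[t2] != 0, Q.[t1] * Q.[t2] != 0, isobaric n P Q &
      x = (P.[t1] * Q.[t2]) / (Q.[t1] * P.[t2])].

Lemma transport0 x : transport 0 x -> x = 1.
Proof.
case=> P [Q [P0 Q0 PQ ->]].
have wPQ : P^`() * Q = P * Q^`().
  apply/eqP; rewrite -subr_eq0; apply/eqP/U_dense => t /PQ.
  by rewrite !mul0r !hornerE.
have [|C PE] := wronskian_proportional _ wPQ.
  by apply: contra_neq Q0 => ->; rewrite horner0 mul0r.
move: P0 Q0; rewrite PE !hornerZ !mulf_eq0 !negb_or => /andP[/andP[C0 _] _].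
by move=> /andP[q1 q2]; field; rewrite C0 q1 q2.
Qed.

Lemma transportM m n x y : transport m x -> transport n y ->
  transport (m + n) (x * y).
Proof.
case=> P [Q [P0 Q0 PQ ->]] [P' [Q' [P'0 Q'0 PQ' ->]]].
exists (P * P'), (Q * Q'); split.
- by rewrite !hornerM mulrACA mulf_neq0.
- by rewrite !hornerM mulrACA mulf_neq0.
- move=> t Ut; rewrite !derivM !(hornerD, hornerM).
  have := PQ t Ut; have := PQ' t Ut; set p := (P^`()).[t]; set q := (Q^`()).[t].
  set p' := (P'^`()).[t]; set q' := (Q'^`()).[t] => e' e.
  transitivity ((p * Q.[t] - P.[t] * q) * (P'.[t] * Q'.[t])
      + (p' * Q'.[t] - P'.[t] * q') * (P.[t] * Q.[t])); first by ring.
  by rewrite e e' natrD; ring.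
- by rewrite !hornerM !invfM; ring.
Qed.

Lemma transportB m n x y : (n <= m)%N -> transport m x -> transport n y ->
  transport (m - n) (x / y).
Proof.
move=> le_nm [P [Q [P0 Q0 PQ ->]]] [P' [Q' [P'0 Q'0 PQ' ->]]].
exists (P * Q'), (Q * P'); split.
- by rewrite !hornerM mulrACA mulf_neq0.
- by rewrite !hornerM mulrACA mulf_neq0.
- move=> t Ut; rewrite !derivM !(hornerD, hornerM).
  have := PQ t Ut; have := PQ' t Ut; set p := (P^`()).[t]; set q := (Q^`()).[t].
  set p' := (P'^`()).[t]; set q' := (Q'^`()).[t] => e' e.
  transitivity ((p * Q.[t] - P.[t] * q) * (P'.[t] * Q'.[t])
      - (p' * Q'.[t] - P'.[t] * q') * (P.[t] * Q.[t])); first by ring.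
  by rewrite e e' natrB //; ring.
- by rewrite !hornerM !invfM !invrK; ring.
Qed.

Lemma transportX n x q : transport n x -> transport (q * n) (x ^+ q).
Proof.
move=> Gx; elim: q => [|q IHq]; last by rewrite mulSn exprS; apply: transportM.
exists 1, 1; rewrite !hornerE; split; rewrite ?oner_eq0 ?mul1r ?invr1 //.
by move=> t _; rewrite -polyC1 derivC horner0 hornerC ?mul0n; ring.
Qed.

(** The weights that occur are the multiples of the least positive one g. If x
    corresponds to g, any g-th root of x extends the homomorphism to all
    integers. *)
Lemma transport_scale : exists2 lam : K, lam != 0 &
  forall n x, (0 < n)%N -> transport n x -> x = lam ^+ n.
Proof.
have [[n0 [n0_gt0 Gn0]]|noG] := pselect (exists n, (0 < n)%N /\ exists x, transport n x);
  last first.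
  by exists 1 => [|n x n_gt0 Gx]; rewrite ?oner_eq0 //; case: noG; exists n; split => //; exists x.
have exG : exists n, (0 < n)%N && `[< exists x, transport n x >].
  by exists n0; rewrite n0_gt0; apply/asboolP.
case: (ex_minnP exG) => g /andP[g_gt0 /asboolP[mu Gmu]] g_min.
have [lam lamE] := exists_rootn mu K_closed g_gt0.
exists lam => [|n x n_gt0 Gx].
  apply/eqP => lam0; move: lamE; rewrite lam0 expr0n gtn_eqF //= => /esym/eqP.
  case: Gmu => P [Q [P0 Q0 _ ->]]; apply/negP.
  by move: P0 Q0; rewrite !(mulf_eq0, negb_or, invr_eq0) => /andP[-> ->] /andP[-> ->].
have Gr : transport (n %% g) (x / mu ^+ (n %/ g)).
  have -> : (n %% g = n - n %/ g * g)%N by rewrite {2}(divn_eq n g) addKn.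
  by apply: transportB => //; [exact: leq_trunc_div | exact: transportX].
have r0 : (n %% g = 0)%N.
  apply/eqP; rewrite -leqn0 leqNgt; apply/negP => r_gt0.
  have := g_min (n %% g)%N; rewrite r_gt0 /= leqNgt ltn_mod g_gt0 => /(_ _)/notF; apply.
  by apply/asboolP; exists (x / mu ^+ (n %/ g)).
move: Gr; rewrite r0 => /transport0 xE.
have mu0 : mu ^+ (n %/ g) != 0.
  by apply/eqP => mu0; move: xE; rewrite mu0 invr0 mulr0 => /esym/eqP; rewrite oner_eq0.
rewrite (divn_eq n g) r0 addn0 mulnC exprM lamE.
by move/(canRL (divfK mu0)): xE; rewrite mul1r.
Qed.

End WeightedScaling.

(** As E_k^l and E_l^k have the same weight k l, they are proportional. So a
    nonzero E_k vanishes at no point of U: all the others would vanish there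
    too, which is excluded. The ratios E_k(t1) / E_k(t2) are then defined, and
    [transport_scale] applies. *)
Lemma weighted_scaling (K : numFieldType) (U : set K) (t1 t2 : K)
    (eta : K -> K) (E : nat -> {poly K}) :
  alg_closed K ->
  (forall p : {poly K}, (forall t, U t -> p.[t] = 0) -> p = 0) ->
  U t1 -> U t2 ->
  (forall t, U t -> forall k, ((E k)^`()).[t] = k%:R * eta t * (E k).[t]) ->
  (forall t, U t -> exists2 k, (0 < k)%N & (E k).[t] != 0) ->
  exists2 lam : K, lam != 0 & forall k, (0 < k)%N -> (E k).[t1] = lam ^+ k * (E k).[t2].
Proof.
move=> K_closed U_dense Ut1 Ut2 dE E_neq0.
have [lam lam0 lamP] := @transport_scale K U eta t1 t2 U_dense K_closed.
exists lam => // k k_gt0.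
have [->|Ek0] := eqVneq (E k) 0; first by rewrite !horner0 mulr0.
have nz t : U t -> (E k).[t] != 0.
  move=> Ut; have [l l_gt0 El] := E_neq0 t Ut.
  have [||C EC] := @wronskian_proportional K (E k ^+ l) (E l ^+ k).
  - by rewrite expf_neq0 //; apply: contra_neq El => ->; rewrite horner0.
  - apply/eqP; rewrite -subr_eq0; apply/eqP/U_dense => s Us.
    have dX (p : {poly K}) n c : (p^`()).[s] = c * p.[s] ->
        ((p ^+ n)^`()).[s] = n%:R * c * (p ^+ n).[s].
      move=> dp; rewrite deriv_exp hornerMn hornerM !horner_exp dp.
      by case: n => [|n]; rewrite ?mulr0n ?mul0r // [in RHS]exprS -mulr_natl; ring.
    rewrite hornerD hornerN !hornerM (dX _ _ _ (dE s Us k)) (dX _ _ _ (dE s Us l)).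
    by ring.
  have C0 : C != 0.
    by apply: contra_neq (expf_neq0 l Ek0) => C0; rewrite EC C0 scale0r.
  have : (E k ^+ l).[t] != 0 by rewrite EC hornerZ horner_exp mulf_neq0 ?expf_neq0.
  by rewrite horner_exp expf_eq0 l_gt0.
have Ek1 := nz _ Ut1; have Ek2 := nz _ Ut2.
apply/(canRL (divfK Ek2))/lamP => //; exists (E k), 1; split.
- by rewrite mulf_neq0.
- by rewrite !hornerE oner_eq0.
- by move=> t Ut; rewrite (dE t Ut) -polyC1 derivC horner0 hornerC; ring.
- by rewrite -polyC1 !hornerC mulr1 mul1r.
Qed.

(** * Recentring a family of one-variable polynomials *)

Lemma horner_inj (K : numFieldType) (p q : {poly K}) :
  (forall x, p.[x] = q.[x]) -> p = q.
Proof.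
move=> pq; apply/eqP; rewrite -subr_eq0; apply/negPn/negP => pq0.
suff: (size (p - q)%R < size (p - q)%R)%N by rewrite ltnn.
rewrite -{1}(size_iota 0 (size (p - q)%R)) -(size_map (fun k => k%:R : K)).
apply: max_poly_roots => //.
  by apply/allP => _ /mapP[k _ ->]; rewrite rootE !hornerE pq subrr.
by rewrite map_inj_uniq ?iota_uniq // => i j /eqP; rewrite eqr_nat => /eqP.
Qed.

(** A family of polynomials in z with parameter t is an element of
    {poly {poly K}}, the inner variable being t. *)
Definition specialize (K : numFieldType) (t : K) (Q : {poly {poly K}}) : {poly K} :=
  map_poly (horner_eval t) Q.

Lemma horner_specialize (K : numFieldType) (t : K) (Q : {poly {poly K}}) (u : {poly K}) :
  (specialize t Q).[u.[t]] = Q.[u].[t].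
Proof. by rewrite /specialize -[u.[t]]/(horner_eval t u) horner_map. Qed.

Definition deriv_param (K : numFieldType) (Q : {poly {poly K}}) : {poly {poly K}} :=
  map_poly (@deriv K) Q.

Lemma coef_deriv_param (K : numFieldType) (Q : {poly {poly K}}) i : (deriv_param Q)`_i = (Q`_i)^`().
Proof. by rewrite coef_map_id0 // deriv0. Qed.

Lemma deriv_horner (K : numFieldType) (Q : {poly {poly K}}) (u : {poly K}) :
  (Q.[u])^`() = (deriv_param Q).[u] + (Q^`()).[u] * u^`().
Proof.
elim/poly_ind: Q => [|Q c IHQ].
  rewrite horner0 !deriv0 (_ : deriv_param 0 = 0) ?horner0 ?mul0r ?addr0 //.
  by apply/polyP => i; rewrite coef_deriv_param !coef0 deriv0.
have -> : deriv_param (Q * 'X + c%:P) = deriv_param Q * 'X + (c^`())%:P.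
  apply/polyP => i; rewrite coef_deriv_param !coefD !coefMX !coefC derivD coef_deriv_param.
  by case: i => [|i]; rewrite ?deriv0.
rewrite !hornerMXaddC derivD derivM IHQ derivMXaddC hornerD hornerM hornerX; ring.
Qed.

Section Centering.
Variables (K : numFieldType) (n : nat) (Phi : {poly {poly K}}).
Hypothesis size_Phi : size Phi = n.+2.
Let l := Phi`_n.+1.
Let b := Phi`_n.
Let M : {poly K} := n.+1%:R.

(** Up to the factor M^(n+1) l^n, this is Phi evaluated at (u - b) / (M l),
    where l and b are the two top coefficients and M = n + 1. That substitution
    moves the barycentre of the roots to 0, and the factor makes the result
    monic with coefficients polynomial in t. *)
Definition centered : {poly {poly K}} :=
  ('X - b%:P) ^+ n.+1 +
  \sum_(j < n.+1) (M ^+ (n.+1 - j) * l ^+ (n - j) * Phi`_j) *: ('X - b%:P) ^+ j.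

Definition recentre (z : K) : {poly K} := M * l * z%:P + b.

Lemma horner_centered z :
  centered.[recentre z] = M ^+ n.+1 * l ^+ n * Phi.[z%:P].
Proof.
have uE : recentre z - b = M * l * z%:P by rewrite addrK.
rewrite /centered hornerD horner_exp hornerXsubC uE horner_sum.
rewrite (horner_coef_wide _ (leqnn _)) size_Phi [in RHS]big_ord_recr /= mulrDr addrC.
congr (_ + _).
  rewrite mulr_sumr; apply: eq_bigr => j _.
  rewrite hornerZ horner_exp hornerXsubC uE.
  have -> : M ^+ n.+1 = M ^+ (n.+1 - j) * M ^+ j.
    by rewrite -exprD subnK // ltnW.
  have -> : l ^+ n = l ^+ (n - j) * l ^+ j.
    by rewrite -exprD subnK // -ltnS.
  rewrite !exprMn; move: (M ^+ (n.+1 - j)) (l ^+ (n - j)) => A B.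
  by move: (M ^+ j) (l ^+ j) (z%:P ^+ j) => C D E; ring.
rewrite -/l !exprMn [l ^+ n.+1]exprSr.
by move: (M ^+ n.+1) (l ^+ n) (z%:P ^+ n.+1) => A B C; ring.
Qed.

Lemma size_centered_tail :
  (size (\sum_(j < n.+1) (M ^+ (n.+1 - j) * l ^+ (n - j) * Phi`_j)
     *: ('X - b%:P) ^+ j)%R <= n.+1)%N.
Proof.
apply: leq_trans (size_sum _ _ _) _; apply/bigmax_leqP => j _.
by apply: leq_trans (size_scale_leq _ _) _; rewrite size_exp_XsubC.
Qed.

Lemma coef_XsubC_exp_top (c : {poly K}) k : (('X - c%:P) ^+ k)`_k = 1.
Proof.
have /monicP := monic_exp k (monicXsubC c).
by rewrite lead_coefE size_exp_XsubC.
Qed.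

Lemma coef_XsubC_exp_pred (c : {poly K}) k : (('X - c%:P) ^+ k.+1)`_k = - (c *+ k.+1).
Proof.
elim: k => [|k IHk]; first by rewrite expr1 coefB coefX coefC sub0r.
rewrite exprSr mulrBr coefB coefMX coefMC IHk coef_XsubC_exp_top.
by rewrite mul1r -opprD -mulrSr.
Qed.

Lemma coef_centered_top : centered`_n.+1 = 1.
Proof.
rewrite coefD [X in _ + X]nth_default ?size_centered_tail // addr0.
exact: coef_XsubC_exp_top.
Qed.

Lemma size_centered : (size centered <= n.+2)%N.
Proof.
apply: leq_trans (size_polyD _ _) _; rewrite geq_max size_exp_XsubC leqnn /=.
exact: leqW size_centered_tail.
Qed.

Lemma coef_centered_pred : centered`_n = 0.
Proof.
rewrite coefD coef_XsubC_exp_pred coef_sum big_ord_recr /= big1 => [|j _].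
  rewrite coefZ coef_XsubC_exp_top subSnn subnn -/b /M.
  by rewrite add0r expr1 expr0 !mulr1 mulr_natl addNr.
by rewrite coefZ [X in _ * X]nth_default ?mulr0 // size_exp_XsubC ltn_ord.
Qed.

(** Recentring conjugates the affine action, so the centred family still
    satisfies an equation Q' = A Q + (al u + be) dQ/du. Its coefficient of
    degree n + 1 is the constant 1 and that of degree n is 0: comparing these
    two coefficients forces be = 0 and A = - (n + 1) al. What is left is the
    weighted scaling with rate - al. *)
Lemma centered_flow t A alpha beta :
  l.[t] != 0 ->
  specialize t (deriv_param Phi) = A *: specialize t Phi + (alpha *: 'X + beta%:P) * (specialize t Phi)^`() ->
  exists h, forall k, (k <= n.+1)%N ->
    ((centered`_(n.+1 - k))^`()).[t] = k%:R * h * (centered`_(n.+1 - k)).[t].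
Proof.
move=> lt0 flow.
pose M0 : K := n.+1%:R.
have M00 : M0 != 0 by rewrite pnatr_eq0.
have Mt : M.[t] = M0 by rewrite /M -polyC_natr hornerC.
have ct0 : M0 ^+ n.+1 * l.[t] ^+ n != 0 by rewrite mulf_neq0 ?expf_neq0.
set c0 := _ * _ in ct0.
pose q := specialize t centered; pose F := specialize t Phi.
have recentreE z : (recentre z).[t] = M0 * l.[t] * z + b.[t].
  by rewrite /recentre hornerD !hornerM Mt hornerC.
have qF z : q.[M0 * l.[t] * z + b.[t]] = c0 * F.[z].
  rewrite -recentreE horner_specialize horner_centered !hornerM !horner_exp Mt.
  by rewrite -horner_specialize hornerC.
have qF_poly : q \Po ((M0 * l.[t]) *: 'X + b.[t]%:P) = c0 *: F.
  by apply: horner_inj => z; rewrite horner_comp !hornerE qF.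
have qF' z : (q^`()).[M0 * l.[t] * z + b.[t]] * (M0 * l.[t]) = c0 * (F^`()).[z].
  move/(congr1 (@deriv K)): qF_poly; rewrite deriv_comp derivD derivZ derivX derivC.
  by rewrite derivZ => /(congr1 (horner^~ z)); rewrite !hornerM horner_comp !hornerE.
pose dl := (l^`()).[t]; pose db := (b^`()).[t].
pose r := ((l ^+ n)^`()).[t] / l.[t] ^+ n.
pose al := alpha - dl / l.[t]; pose be := M0 * l.[t] * beta - db - al * b.[t].
have qflow : specialize t (deriv_param centered) = (A + r) *: q + (al *: 'X + be%:P) * q^`().
  apply: horner_inj => w.
  pose z := (w - b.[t]) / (M0 * l.[t]).
  have wE : w = M0 * l.[t] * z + b.[t].
    by rewrite /z mulrC divfK ?subrK // mulf_neq0.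
  have dPhi : (Phi.[z%:P])^`().[t] = (specialize t (deriv_param Phi)).[z].
    by rewrite deriv_horner derivC mulr0 addr0 -horner_specialize hornerC.
  have drecentre : (recentre z)^`().[t] = M0 * dl * z + db.
    rewrite /recentre derivD !derivM derivC [M^`()](_ : _ = 0); last first.
      by rewrite /M -polyC_natr derivC.
    by rewrite mulr0 addr0 mul0r add0r hornerD !hornerM Mt hornerC.
  have ME : M ^+ n.+1 = (M0 ^+ n.+1)%:P by rewrite /M -polyC_natr polyC_exp.
  have := congr1 (horner^~ t) (congr1 (@deriv K) (horner_centered z)).
  rewrite deriv_horner ME -mulrA mul_polyC derivZ derivM hornerD hornerM drecentre.
  rewrite -!horner_specialize recentreE -wE hornerZ hornerD !hornerM dPhi flow.
  rewrite horner_exp -horner_specialize hornerC.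
  have -> : specialize t centered^`() = q^`() by rewrite /specialize -deriv_map.
  rewrite -/F !(hornerD, hornerM, hornerZ, hornerX, hornerC).
  have := qF z; have := qF' z; rewrite -wE => e' e eq.
  have {}eq : (specialize t (deriv_param centered)).[w] = M0 ^+ n.+1 * ((l ^+ n)^`().[t] * F.[z] +
      l.[t] ^+ n * (A * F.[z] + (alpha * z + beta) * F^`().[z]))
      - q^`().[w] * (M0 * dl * z + db) by rewrite -eq addrK.
  rewrite eq e.
  have -> : M0 ^+ n.+1 * ((l ^+ n)^`().[t] * F.[z] + l.[t] ^+ n *
      (A * F.[z] + (alpha * z + beta) * F^`().[z])) =
      (A + r) * (c0 * F.[z]) + (alpha * z + beta) * (c0 * F^`().[z]).
    by rewrite /r /c0; field; rewrite expf_neq0.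
  rewrite -e' /be /al wE; field.
  by rewrite lt0.
have coef_flow i : (centered`_i)^`().[t] = (A + r) * (centered`_i).[t] +
    al * i%:R * (centered`_i).[t] + be * i.+1%:R * (centered`_i.+1).[t].
  have qi j : q`_j = (centered`_j).[t] by rewrite coef_map.
  have := congr1 (fun p : {poly K} => p`_i) qflow.
  rewrite coef_map coef_deriv_param /= /horner_eval => ->.
  rewrite coefD coefZ [(_ + _%:P) * _]mulrDl coefD -scalerAl coefZ coefXM coefCM !coef_deriv !qi.
  by case: i => [|i] /=; ring.
have be0 : be = 0.
  have := coef_flow n; rewrite coef_centered_pred coef_centered_top deriv0 -polyC1.
  rewrite horner0 hornerC !mulr0 add0r add0r mulr1 => /esym/eqP.
  by rewrite mulf_eq0 (negPf M00) orbF => /eqP.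
have Ar : A + r = - (al * M0).
  have := coef_flow n.+1; rewrite coef_centered_top be0 -polyC1 derivC horner0.
  rewrite hornerC !mul0r addr0 !mulr1 => /esym/eqP.
  by rewrite addr_eq0 => /eqP.
exists (- al) => k le_k.
by rewrite coef_flow be0 Ar natrB // -/M0; ring.
Qed.

End Centering.

(** The centred families at t1 and t2 differ by a dilation of the variable, by
    [weighted_scaling]. Its nonvanishing hypothesis is where simple roots are
    used: if all the lower coefficients vanished at t, then F_t would be a
    constant times the (n + 1)-st power of a linear form. *)
Lemma affine_rigidity (K : numFieldType) (U : set K) (t1 t2 : K) (n : nat)
    (Phi : {poly {poly K}}) :
  alg_closed K ->
  (forall p : {poly K}, (forall t, U t -> p.[t] = 0) -> p = 0) ->
  U t1 -> U t2 -> size Phi = n.+2 ->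
  (forall t, U t -> (Phi`_n.+1).[t] != 0) ->
  (forall t, U t -> exists A alpha beta, specialize t (deriv_param Phi) =
     A *: specialize t Phi + (alpha *: 'X + beta%:P) * (specialize t Phi)^`()) ->
  (forall t c, U t -> (specialize t Phi).[c] = 0 -> (specialize t Phi)^`().[c] != 0) ->
  exists kap be ga, [/\ kap != 0, be != 0, (Phi`_n = 0 -> ga = 0) &
    forall c, (specialize t1 Phi).[c] = kap * (specialize t2 Phi).[be * c + ga]].
Proof.
move=> K_closed U_dense Ut1 Ut2 size_Phi l_neq0 flow simple.
pose M0 : K := n.+1%:R; pose l := Phi`_n.+1; pose b := Phi`_n.
have M00 : M0 != 0 by rewrite pnatr_eq0.
have Mt t : (n.+1%:R : {poly K}).[t] = M0 by rewrite -polyC_natr hornerC.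
pose Q t := specialize t (centered n Phi).
have QE t c : (Q t).[M0 * l.[t] * c + b.[t]] =
    M0 ^+ n.+1 * l.[t] ^+ n * (specialize t Phi).[c].
  have := congr1 (horner^~ t) (horner_centered size_Phi c).
  rewrite -horner_specialize /recentre hornerD !hornerM !horner_exp !Mt -horner_specialize.
  by rewrite !hornerC.
have c_neq0 t : U t -> M0 ^+ n.+1 * l.[t] ^+ n != 0.
  by move=> Ut; rewrite mulf_neq0 ?expf_neq0 ?l_neq0.
have QsumE t w : (Q t).[w] = \sum_(i < n.+2) ((centered n Phi)`_i).[t] * w ^+ i.
  rewrite (@horner_coef_wide _ n.+2); last first.
    exact: leq_trans (size_poly _ _) (size_centered _ _).
  by apply: eq_bigr => i _; rewrite coef_map.
pose E k := if (k <= n.+1)%N then (centered n Phi)`_(n.+1 - k) else 0.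
have /choice[eta etaP] : forall t, exists h, U t -> forall k,
    (E k)^`().[t] = k%:R * h * (E k).[t].
  move=> t; have [Ut|nUt] := pselect (U t); last by exists 0.
  have [A [al [be fl]]] := flow t Ut.
  have [h hP] := centered_flow size_Phi (l_neq0 t Ut) fl.
  exists h => _ k; rewrite /E; case: ifP => [/hP//|_].
  by rewrite deriv0 !horner0 mulr0.
have [lam lam0 lamP] : exists2 lam, lam != 0 &
    forall k, (0 < k)%N -> (E k).[t1] = lam ^+ k * (E k).[t2].
  (* For n = 0 the centred polynomial is the variable itself. *)
  have [n0|n_gt0] := posnP n.
    exists 1 => [|[|[|k]] // _]; rewrite ?oner_eq0 // /E n0 /=.
      by have := coef_centered_pred n Phi; rewrite n0 => ->; rewrite !horner0 mulr0.
    by rewrite !horner0 mulr0.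
  apply: (weighted_scaling K_closed U_dense Ut1 Ut2 etaP) => t Ut; apply: contrapT => noE.
  have E0 k : (0 < k)%N -> (E k).[t] = 0.
    by move=> k_gt0; apply/eqP/negPn/negP => Ek; apply: noE; exists k.
  have QX w : (Q t).[w] = w ^+ n.+1.
    rewrite QsumE big_ord_recr /= coef_centered_top -polyC1 hornerC mul1r big1 ?add0r //.
    move=> i _; have := E0 (n.+1 - i)%N; rewrite /E leq_subr subKn; last exact: ltnW.
    by rewrite subn_gt0 ltn_ord => ->; rewrite ?mul0r.
  have FE : (M0 ^+ n.+1 * l.[t] ^+ n) *: specialize t Phi =
      ((M0 * l.[t]) *: 'X + b.[t]%:P) ^+ n.+1.
    by apply: horner_inj => c; rewrite hornerZ -QE QX !hornerE.
  pose c := - b.[t] / (M0 * l.[t]).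
  have lc0 : ((M0 * l.[t]) *: 'X + b.[t]%:P).[c] = 0.
    by rewrite hornerD hornerZ hornerX hornerC [X in X + _]mulrC divfK ?addNr // mulf_neq0 ?l_neq0.
  have := simple t c Ut; rewrite (_ : (specialize t Phi).[c] = 0); last first.
    apply: (mulfI (c_neq0 t Ut)); rewrite -hornerZ FE horner_exp lc0.
    by rewrite expr0n mulr0.
  move=> /(_ erefl)/negP; apply; apply/eqP/(mulfI (c_neq0 t Ut)).
  rewrite -hornerZ -derivZ FE deriv_exp hornerMn hornerM horner_exp lc0.
  by rewrite expr0n /= gtn_eqF // mulr0 mul0rn mulr0.
have Qlam w : (Q t1).[w] = lam ^+ n.+1 * (Q t2).[w / lam].
  rewrite !QsumE mulr_sumr; apply: eq_bigr => i _.
  have -> : ((centered n Phi)`_i).[t1] = lam ^+ (n.+1 - i) * ((centered n Phi)`_i).[t2].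
    have [i_lt|i_ge] := ltnP i n.+1.
      have := lamP (n.+1 - i)%N; rewrite subn_gt0 i_lt /E leq_subr subKn; last exact: ltnW.
      exact.
    have -> : i = n.+1 :> nat by apply/eqP; rewrite eqn_leq i_ge -ltnS ltn_ord.
    by rewrite subnn coef_centered_top -polyC1 !hornerC mulr1.
  have -> : lam ^+ n.+1 = lam ^+ (n.+1 - i) * lam ^+ i.
    by rewrite -exprD subnK // -ltnS.
  rewrite expr_div_n.
  have := expf_neq0 i lam0; move: (lam ^+ (n.+1 - i)) (lam ^+ i) (w ^+ i) => x y z y0.
  by field.
have l10 := l_neq0 _ Ut1; have l20 := l_neq0 _ Ut2.
exists (lam ^+ n.+1 * (M0 ^+ n.+1 * l.[t2] ^+ n) / (M0 ^+ n.+1 * l.[t1] ^+ n)).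
exists (l.[t1] / (lam * l.[t2])), ((b.[t1] / lam - b.[t2]) / (M0 * l.[t2])); split.
- by rewrite !mulf_neq0 ?invr_eq0 ?c_neq0 ?expf_neq0.
- by rewrite !mulf_neq0 ?invr_eq0 ?mulf_neq0.
- by move=> b0; rewrite /b b0 !horner0 mul0r subrr mul0r.
move=> c; apply: (mulfI (c_neq0 _ Ut1)); rewrite -QE Qlam.
rewrite mulrA [X in _ = X * _]mulrC divfK ?c_neq0 // -(mulrA (lam ^+ n.+1)) -QE; congr (_ * _.[_]).
by move: (M00); move: (M0) => x x0; field; rewrite x0 lam0 l20.
Qed.

(** * Lipschitz vector fields and the infinitesimal affine action *)

Lemma is_derive_horner (K : numFieldType) (p : {poly K}) (x v : K) :
  is_derive x v (horner p) (v * p^`().[x]).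
Proof.
elim/poly_ind: p => [|p c IHp].
  rewrite deriv0 horner0 mulr0 (_ : horner 0 = cst 0); first exact: is_derive_cst.
  by apply/funext => y; rewrite horner0.
rewrite (_ : horner _ = horner p * id + cst c); last first.
  by apply/funext => y; rewrite hornerMXaddC.
apply: is_derive_eq; rewrite derivMXaddC !hornerE /= /GRing.scale /=; ring.
Qed.

Lemma poly_continuous (K : numFieldType) (p : {poly K}) : continuous (horner p).
Proof.
move=> x; apply/differentiable_continuous/derivable1_diffP.
exact: (@ex_derive _ _ _ _ _ _ _ (is_derive_horner p x 1)).
Qed.

Lemma poly_neq0_near (K : numFieldType) (p : {poly K}) (a : K) :
  p != 0 -> \forall x \near a^', p.[x] != 0.
Proof.
move=> p0; have [k [q]] := multiplicity_XsubC p a.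
rewrite p0 /= => qa ->.
have : \forall x \near a, q.[x] != 0.
  have /cvgrPdist_lt/(_ `|q.[a]|) := @poly_continuous K q a.
  rewrite normr_gt0 => /(_ qa); apply: filterS => x; apply: contraTneq => ->.
  by rewrite subr0 ltxx.
move=> qx; near=> x; rewrite hornerM horner_exp hornerXsubC mulf_neq0 //.
  by near: x; apply: nbhs_dnbhs.
by rewrite expf_neq0 // subr_eq0; near: x; exact: nbhs_dnbhs_neq.
Unshelve. all: by end_near. Qed.

Lemma poly_eq0_near (K : numFieldType) (p : {poly K}) (a : K) :
  (\forall x \near a, p.[x] = 0) -> p = 0.
Proof.
move=> p_a; apply/eqP/negPn/negP => /(@poly_neq0_near _ _ a) p_a'.
have /filter_ex[x [/eqP]] : \forall x \near a^', p.[x] != 0 /\ p.[x] = 0.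
  by near=> x; split; near: x => //; apply: nbhs_dnbhs.
by [].
Unshelve. all: by end_near. Qed.

(** A root r of P is a root of H by continuity; then X - r can be cancelled on
    both sides of the inequality, away from r. Keeping track of the exceptional
    points as roots of Z lets the induction on the degree of P go through. *)
Lemma dvdp_of_bound (K : numFieldType) (P H Z : {poly K}) (B0 B1 : K) :
  alg_closed K -> P != 0 -> Z != 0 ->
  (forall c, Z.[c] != 0 -> `|H.[c]| <= (B0 + B1 * `|c|) * `|P.[c]|) -> P %| H.
Proof.
move=> K_closed; move sP : (size P) => n; elim: n P H Z sP => [|n IHn] P H Z sP P0 Z0 bound.
  by move/eqP: sP; rewrite size_poly_eq0 (negPf P0).
have [sP1|sP1] := eqVneq (size P) 1%N.
  by move/eqP: sP1 => /size_poly1P[c c0 ->]; rewrite -alg_polyC dvdpZl ?dvd1p.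
have [r rP] : exists r : K, root P r := K_closed _ sP1.
have Hr : H.[r] = 0.
  apply/eqP/negPn/negP => Hr.
  have Hr2 : 0 < `|H.[r]| / 2 by rewrite divr_gt0 ?normr_gt0.
    (* If H did not vanish at r, then near r the value of H would stay larger
     than half its value at r, whereas the bound b tends to 0. *)
pose b (c : K) := (B0 + B1 * `|c|) * `|P.[c]|.
  have b_cvg : b @ r --> (0 : K).
    rewrite [X in _ --> X](_ : 0 = (B0 + B1 * `|r|) * `|P.[r]|); last first.
      by rewrite (rootP rP) normr0 mulr0.
    apply: (@cvgM K K (nbhs r) _); last first.
      exact: (@cvg_norm K K K (nbhs r) _ _ _ (@poly_continuous K P r)).
    apply: (@cvgD K K K (nbhs r) _); first exact: (@cvg_cst K B0 K (nbhs r) _).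
    apply: (@cvgM K K (nbhs r) _); first exact: (@cvg_cst K B1 K (nbhs r) _).
    by apply: (@cvg_norm K K K (nbhs r) _); exact: cvg_id.
  have nb : \forall c \near r^', `|b c| < `|H.[r]| / 2.
    by apply: nbhs_dnbhs; move/cvgr0Pnorm_lt : b_cvg; apply.
  have nH : \forall c \near r^', `|H.[r] - H.[c]| < `|H.[r]| / 2.
    by apply: nbhs_dnbhs; have /cvgrPdist_lt := @poly_continuous K H r; apply.
  have nZ := poly_neq0_near r Z0.
  have : nbhs r^' [set c : K | [/\ `|b c| < `|H.[r]| / 2,
      `|H.[r] - H.[c]| < `|H.[r]| / 2 & Z.[c] != 0]].
    by near=> c; split; near: c.
  move=> /filter_ex[c [bc Hc Zc]].
  have : `|H.[r]| < `|H.[r]|; last by rewrite ltxx.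
  rewrite [X in _ < X](splitr `|H.[r]|) -{1}(subrK H.[c] H.[r]).
  apply: le_lt_trans (ler_normD _ _) _; apply: ltrD => //.
  apply: le_lt_trans (bound c Zc) _.
  apply: le_lt_trans bc; rewrite real_ler_norm // ger0_real //.
  exact: le_trans (normr_ge0 _) (bound c Zc).
have /factor_theorem[P1 PE] := rP; have /rootP/factor_theorem[H1 HE] := Hr.
rewrite PE HE dvdp_mul2r ?polyXsubC_eq0 //.
have P10 : P1 != 0 by apply: contra_neq P0 => P10; rewrite PE P10 mul0r.
apply: (IHn P1 H1 (Z * ('X - r%:P))) => //.
- by move: sP; rewrite PE size_Mmonic ?monicXsubC // size_XsubC addn2 => -[].
- by rewrite mulf_neq0 // polyXsubC_eq0.
move=> c; rewrite hornerM mulf_eq0 negb_or hornerXsubC => /andP[Zc cr].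
have := bound c Zc; rewrite PE HE !hornerM hornerXsubC !normrM mulrA.
by rewrite ler_pM2r // normr_gt0.
Unshelve. all: by end_near. Qed.

Lemma le_of_near0 (K : numFieldType) (x y a : K) e :
  x \is Num.real -> y \is Num.real -> 0 <= a -> (0 < e)%N ->
  (\forall s \near 0^', x <= a * `|(s : K)| ^+ e + y) -> x <= y.
Proof.
move=> xr yr a0 e_gt0 near_le.
case: (real_leP xr yr) => // ltyx.
pose p := a *: 'X^e : {poly K}.
have p0 : p.[0] = 0 by rewrite hornerZ hornerXn expr0n gtn_eqF // mulr0.
have np : \forall s \near (0 : K)^', `|p.[0] - p.[s]| < x - y.
  apply: nbhs_dnbhs; have /cvgrPdist_lt := @poly_continuous K p 0; apply.
  by rewrite subr_gt0.
have : nbhs (0 : K)^' [set s : K | x <= a * `|s| ^+ e + y /\ `|p.[0] - p.[s]| < x - y].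
  by near=> s; split; near: s.
move=> /filter_ex[s [xle]].
rewrite p0 sub0r normrN hornerZ hornerXn normrM normrX (ger0_norm a0).
by rewrite ltrBrDr => /(le_lt_trans xle); rewrite ltxx.
Unshelve. all: by end_near. Qed.

Lemma size_deriv_num (K : numFieldType) (p : {poly K}) n :
  size p = n.+2 -> size p^`() = n.+1.
Proof.
move=> sp; have p0 : p != 0 by rewrite -size_poly_eq0 sp.
apply/eqP; rewrite eqn_leq -ltnS -sp lt_size_deriv // ltnNge.
apply/negP => /leq_sizeP/(_ n (leqnn n))/eqP; rewrite coef_deriv mulrn_eq0 /=.
by have := lead_coef_eq0 p; rewrite lead_coefE sp /= => ->; apply/negP.
Qed.

(** V1 and V2 are the components of the vector field at the point
    (s^w1, z s^w2), divided by s^w1 and s^w2. *)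
Section LipschitzFlow.
Variables (K : numFieldType) (F G : {poly K}) (d w1 w2 e n : nat).
Variables (V1 V2 : K -> K -> K) (L : K).
Hypotheses (K_closed : alg_closed K) (d_gt0 : (0 < d)%N) (w1_gt0 : (0 < w1)%N).
Hypotheses (e_gt0 : (0 < e)%N) (L_ge0 : 0 <= L).
Hypotheses (size_F : size F = n.+2) (size_G : (size G <= n.+2)%N).
Hypothesis simple : forall c, F.[c] = 0 -> F^`().[c] != 0.
Hypothesis V_eq : forall c, \forall s \near (0 : K)^', w1%:R * G.[c] =
  (d%:R * F.[c] - w2%:R * c * F^`().[c]) * V1 s c + w1%:R * F^`().[c] * V2 s c.
Hypothesis V1_lip : forall s c c', s != 0 ->
  `|V1 s c - V1 s c'| <= L * `|s| ^+ e * `|c - c'|.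
Hypothesis V2_lip : forall s c c', s != 0 -> `|V2 s c - V2 s c'| <= L * `|c - c'|.

(** On critical points of F the vector field enters through V1 alone, which
    fixes the limit A1 of V1 as s tends to 0. The quotient of
    w1 G - d A1 F by F' is then, up to terms in |s|^e, a combination of V2 and
    of z, hence Lipschitz in z with a constant that does not depend on s. *)
Lemma dvdp_flow : exists A, F^`() %| G - A *: F.
Proof.
have sF' := size_deriv_num size_F.
have F'0 : F^`() != 0 by rewrite -size_poly_eq0 sF'.
have [sF1|sF1] := eqVneq (size F^`()) 1.
  by exists 0; move/eqP: sF1 => /size_poly1P[c c0 ->]; rewrite -alg_polyC dvdpZl ?dvd1p.
have [c0 c0P] : exists c0 : K, root F^`() c0 := K_closed sF1.
have F'c0 := rootP c0P.
have Fc0 : F.[c0] != 0 by apply/eqP => /simple; rewrite F'c0 eqxx.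
have dF0 : d%:R * F.[c0] != 0 by rewrite mulf_neq0 // pnatr_eq0 -lt0n.
have w10 : w1%:R != 0 :> K by rewrite pnatr_eq0 -lt0n.
pose A1 := w1%:R * G.[c0] / (d%:R * F.[c0]).
have V1c0 : \forall s \near (0 : K)^', V1 s c0 = A1.
  apply: filterS (V_eq c0) => s.
  rewrite F'c0 !mulr0 mul0r subr0 addr0 /A1 => ->.
  by rewrite mulrC mulKf.
have [c1 F'c1] : exists c1, F^`().[c1] != 0.
  apply: contrapT => noc; move/eqP: F'0; apply; apply: horner_inj => c.
  by rewrite horner0; apply/eqP/negPn/negP => Fc; apply: noc; exists c.
pose H := w1%:R *: G - (d%:R * A1) *: F.
pose k c := (d%:R * F.[c] - w2%:R * c * F^`().[c]) / F^`().[c].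
have HE c : F^`().[c] != 0 -> \forall s \near (0 : K)^',
    H.[c] / F^`().[c] = k c * (V1 s c - V1 s c0) + w1%:R * V2 s c - w2%:R * c * A1.
  move=> F'c; near=> s; have V1s : V1 s c0 = A1 by near: s.
  have Vs : w1%:R * G.[c] = (d%:R * F.[c] - w2%:R * c * F^`().[c]) * V1 s c
      + w1%:R * F^`().[c] * V2 s c by near: s; exact: V_eq.
  rewrite V1s /H hornerD hornerN !hornerZ Vs /k; field.
  by rewrite F'c.
pose C := w1%:R * L + w2%:R * `|A1|.
have C_ge0 : 0 <= C by rewrite addr_ge0 // mulr_ge0 // ler0n.
have Hlip c : F^`().[c] != 0 ->
    `|H.[c] / F^`().[c] - H.[c1] / F^`().[c1]| <= C * `|c - c1|.
  move=> F'c.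
  apply: (@le_of_near0 K _ _ (`|k c| * (L * `|c - c0|) + `|k c1| * (L * `|c1 - c0|)) e) => //.
  - by rewrite ger0_real // mulr_ge0.
  - by rewrite addr_ge0 // !mulr_ge0.
  near=> s.
  have s0 : s != 0 by near: s; exact: nbhs_dnbhs_neq.
  have -> : H.[c] / F^`().[c] = k c * (V1 s c - V1 s c0) + w1%:R * V2 s c - w2%:R * c * A1.
    by near: s; exact: HE.
  have -> : H.[c1] / F^`().[c1] =
      k c1 * (V1 s c1 - V1 s c0) + w1%:R * V2 s c1 - w2%:R * c1 * A1.
    by near: s; exact: HE.
  have -> : k c * (V1 s c - V1 s c0) + w1%:R * V2 s c - w2%:R * c * A1 -
      (k c1 * (V1 s c1 - V1 s c0) + w1%:R * V2 s c1 - w2%:R * c1 * A1) =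
      (k c * (V1 s c - V1 s c0) - k c1 * (V1 s c1 - V1 s c0)) +
      (w1%:R * (V2 s c - V2 s c1) - w2%:R * A1 * (c - c1)) by ring.
  apply: le_trans (ler_normD _ _) _; apply: lerD.
    apply: le_trans (ler_normB _ _) _; rewrite (normrM (k c)) (normrM (k c1)) mulrDl.
    by apply: lerD; rewrite -[X in _ <= X]mulrA ler_wpM2l // mulrAC V1_lip.
  apply: le_trans (ler_normB _ _) _; rewrite (normrM w1%:R) (normrM (w2%:R * A1)) (normrM w2%:R) !normr_nat mulrDl.
  by apply: lerD => //; rewrite -[X in _ <= X]mulrA ler_wpM2l ?ler0n // V2_lip.
exists (d%:R * A1 / w1%:R).
have -> : G - (d%:R * A1 / w1%:R) *: F = w1%:R^-1 *: H.
  by rewrite /H scalerBr !scalerA mulVf // scale1r [_^-1 * _]mulrC.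
rewrite dvdpZr ?invr_eq0 //.
pose q1 := `|H.[c1] / F^`().[c1]|.
apply: (@dvdp_of_bound K _ H F^`() (q1 + C * `|c1|) C) => // c F'c.
have {1}-> : H.[c] = H.[c] / F^`().[c] * F^`().[c] by rewrite divfK.
rewrite normrM ler_wpM2r //.
rewrite -(subrK (H.[c1] / F^`().[c1]) (H.[c] / F^`().[c])).
apply: le_trans (ler_normD _ _) _; rewrite -/q1 addrC -addrA lerD2l.
apply: le_trans (Hlip c F'c) _; rewrite -mulrDr ler_wpM2l //.
by rewrite [X in _ <= X]addrC; exact: ler_normB.
Unshelve. all: by end_near. Qed.

Lemma lipschitz_flow : exists A alpha beta,
  G = A *: F + (alpha *: 'X + beta%:P) * F^`().
Proof.
have sF' := size_deriv_num size_F.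
have F'0 : F^`() != 0 by rewrite -size_poly_eq0 sF'.
have [A /dvdpP[q qE]] := dvdp_flow.
(* F' has size n + 1 and the dividend has size at most n + 2. *)
exists A, q`_1, q`_0.
have sq : (size q <= 2)%N.
  have [->|q0] := eqVneq q 0; first by rewrite size_poly0.
  have : (size (q * F^`())%R <= n.+2)%N.
    rewrite -qE (leq_trans (size_polyD _ _)) // geq_max size_G size_polyN.
    by rewrite (leq_trans (size_scale_leq _ _)) // size_F.
  by rewrite size_mul // sF' addnS -[n.+2]add2n leq_add2r.
have -> : q`_1 *: 'X + (q`_0)%:P = q.
  apply/polyP => i; rewrite coefD coefZ coefX coefC.
  case: i => [|[|i]]; rewrite /= ?mulr0 ?mulr1 ?add0r ?addr0 //.
  by rewrite nth_default // (leq_trans sq).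
by rewrite -qE addrC subrK.
Qed.

End LipschitzFlow.

(** * Weighted homogeneous polynomial families in two variables *)

(** Collecting the terms of a polynomial in x, y, t according to their
    exponents in x and y. *)
Lemma sum_by_exponents (K : numFieldType) (T : finType) (e0 e1 e2 : T -> nat) (c : T -> K) :
  exists N (b : nat -> nat -> {poly K}),
  (forall i j, b i j != 0 -> (i < N)%N && (j < N)%N) /\
  forall x y t, \sum_m c m * (x ^+ e0 m * y ^+ e1 m * t ^+ e2 m) =
    \sum_(i < N) \sum_(j < N) (b i j).[t] * x ^+ i * y ^+ j.
Proof.
pose N := (\max_m (e0 m + e1 m)).+1.
pose b i j := \sum_(m | (e0 m == i) && (e1 m == j)) c m *: 'X^(e2 m).
have ltN m : (e0 m < N)%N && (e1 m < N)%N.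
  rewrite !ltnS; have le := @leq_bigmax T (fun m => e0 m + e1 m)%N m.
  by rewrite (leq_trans _ le) ?leq_addr // (leq_trans _ le) ?leq_addl.
exists N, b; split=> [i j|x y t].
  apply: contra_neqT => ijN; rewrite /b big1 // => m.
  by case/andP=> /eqP im /eqP jm; move: (ltN m) ijN; rewrite -im -jm => ->.
under [RHS]eq_bigr => i _ do under eq_bigr => j _ do
  rewrite /b horner_sum -mulrA mulr_suml big_mkcond /=.
under [RHS]eq_bigr => i _ do rewrite exchange_big /=.
rewrite exchange_big /=; apply: eq_bigr => m _.
have /andP[m0N m1N] := ltN m.
rewrite (bigD1 (Ordinal m0N)) //= (bigD1 (Ordinal m1N)) //= !eqxx /=.
rewrite big1 ?addr0 => [|j]; last first.
  by rewrite -val_eqE /= eq_sym => /negPf ->.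
rewrite big1 ?addr0 => [|i]; last first.
  rewrite -val_eqE /= => /negPf im; rewrite big1 // => j _.
  by rewrite eq_sym im.
rewrite hornerZ hornerXn; move: (c m) (x ^+ _) (y ^+ _) (t ^+ _) => c1 x1 y1 t1; ring.
Qed.

Lemma member_expansion (K : numFieldType) (F : 'rV[K]_(2 + 1) -> K) :
  polynomial_function F -> exists N (b : nat -> nat -> {poly K}),
  (forall i j, b i j != 0 -> (i < N)%N && (j < N)%N) /\
  forall t x, member F t x =
    \sum_(i < N) \sum_(j < N) (b i j).[t] * x ord0 ord0 ^+ i * x ord0 ord_max ^+ j.
Proof.
case=> P FE; pose s := mpoly.msupp P; pose m i := tnth (in_tuple s) i.
have [N [b [bN bE]]] := @sum_by_exponents K 'I_(size s)
  (fun i => mpoly.fun_of_multinom (m i) (lshift 1 ord0))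
  (fun i => mpoly.fun_of_multinom (m i) (lshift 1 ord_max))
  (fun i => mpoly.fun_of_multinom (m i) (rshift 2 ord0))
  (fun i => mpoly.mcoeff (m i) P).
exists N, b; split=> // t x; rewrite -bE /member FE mpoly.mevalE big_tnth.
apply: eq_bigr => i _; congr (_ * _).
rewrite big_split_ord /= big_ord1 big_ord_recl big_ord1 !row_mxEl row_mxEr mxE.
by congr (x _ _ ^+ _ * x _ _ ^+ _ * _); rewrite /m; do ?congr mpoly.fun_of_multinom; apply/val_inj.
Qed.

Lemma coef_eq0_of_vanish2 (K : numFieldType) N (c : nat -> nat -> K) :
  (forall x y, \sum_(i < N) \sum_(j < N) c i j * x ^+ i * y ^+ j = 0) ->
  forall i j, (i < N)%N -> (j < N)%N -> c i j = 0.
Proof.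
move=> c0 i j iN jN.
have pi y : \sum_(j < N) c i j * y ^+ j = 0.
  have : \poly_(i < N) (\sum_(j < N) c i j * y ^+ j) = 0.
    apply: horner_inj => x; rewrite horner_poly horner0; apply: etrans (c0 x y).
    apply: eq_bigr => k _; rewrite mulr_suml; apply: eq_bigr => l _.
    by rewrite mulrAC.
  by move/(congr1 (fun p : {poly K} => p`_i)); rewrite coef_poly iN coef0.
have : \poly_(j < N) c i j = 0.
  by apply: horner_inj => x; rewrite horner_poly horner0 pi.
by move/(congr1 (fun p : {poly K} => p`_j)); rewrite coef_poly jN coef0.
Qed.

Definition vec2 (K : numFieldType) (x y : K) : 'rV[K]_2 :=
  \row_i (if i == ord0 then x else y).

Lemma vec2E0 (K : numFieldType) (x y : K) : vec2 x y ord0 ord0 = x.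
Proof. by rewrite mxE. Qed.

Lemma vec2E1 (K : numFieldType) (x y : K) : vec2 x y ord0 ord_max = y.
Proof. by rewrite mxE. Qed.

Lemma vec2_eta (K : numFieldType) (v : 'rV[K]_2) :
  v = vec2 (v ord0 ord0) (v ord0 ord_max).
Proof.
apply/rowP => i; rewrite mxE -val_eqE /=.
by case: i => [[|[|k]] ltk] //=; congr (v _ _); exact/val_inj.
Qed.

(** Scaling by s = 2 is enough, as the powers of 2 are distinct. *)
Lemma weight_of_homogeneous (K : numFieldType) (w : 'I_2 -> nat) d N
    (c : nat -> nat -> K) (f : 'rV[K]_2 -> K) :
  (forall x, f x = \sum_(i < N) \sum_(j < N) c i j * x ord0 ord0 ^+ i * x ord0 ord_max ^+ j) ->
  w_homogeneous w d f -> forall i j, (i < N)%N -> (j < N)%N -> c i j != 0 ->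
  (w ord0 * i + w ord_max * j)%N = d.
Proof.
move=> fE hf i j iN jN cij.
have two0 : 2 != 0 :> K by rewrite pnatr_eq0.
pose c' i j := c i j * (2 ^+ (w ord0 * i + w ord_max * j) - 2 ^+ d).
suff vanish x y : \sum_(i < N) \sum_(j < N) c' i j * x ^+ i * y ^+ j = 0.
  have /eqP := coef_eq0_of_vanish2 vanish iN jN.
  rewrite mulf_eq0 (negPf cij) subr_eq0 -!natrX eqr_nat eqn_exp2l //.
  by move/eqP.
have := hf 2 two0 (vec2 x y); rewrite !fE vec2E0 vec2E1 !mxE.
move/eqP; rewrite -subr_eq0 => /eqP; rewrite mulr_sumr -sumrB => h.
apply: etrans h; apply: eq_bigr => k _; rewrite mulr_sumr -sumrB; apply: eq_bigr => l _.
by rewrite /c' !exprMn exprD !exprM; move: (c k l) => ckl; ring.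
Qed.

Section Differential.
Variables (K : numFieldType) (n : nat) (I : nat -> nat) (c : nat -> K).

Definition graded_sum (v : 'rV[K]_2) :=
  \sum_(j < n) c j * v ord0 ord0 ^+ I j * v ord0 ord_max ^+ j.

Lemma is_derive_coord (v h : 'rV[K]_2) i :
  is_derive v h (fun x : 'rV[K]_2 => x ord0 i) (h ord0 i).
Proof.
have @f : {linear 'rV[K]_2 -> K}.
  by exists (fun N : 'rV[K]_2 => N ord0 i); do 2![eexists]; do ?[constructor];
     rewrite ?mxE// => ? *; rewrite ?mxE//; move=> ?; rewrite !mxE.
have fE : (fun x : 'rV[K]_2 => x ord0 i) = f by [].
have cf : continuous f by exact: coord_continuous.
have df : differentiable f v by exact: linear_differentiable.
rewrite fE; apply: DeriveDef; first exact: diff_derivable.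
by rewrite deriveE // diff_lin.
Qed.

Let term j (v : 'rV[K]_2) := c j * v ord0 ord0 ^+ I j * v ord0 ord_max ^+ j.

Lemma graded_sumE : graded_sum = \sum_(j < n) term j.
Proof. by apply/funext => v; rewrite fct_sumE. Qed.

Lemma differentiable_graded_sum v : differentiable graded_sum v.
Proof.
rewrite graded_sumE; apply: differentiable_sum => j.
have -> : term j = cst (c j) * (fun x : 'rV[K]_2 => x ord0 ord0) ^+ I j
    * (fun x : 'rV[K]_2 => x ord0 ord_max) ^+ j.
  by apply/funext => x; rewrite /term /= !fctE.
do 2?apply: differentiableM.
- exact: differentiable_cst.
- by case: (I j) => [|k]; [exact: differentiable_cst
    | apply: differentiableX; exact: differentiable_coord].
- by case: (j : nat) => [|k]; [exact: differentiable_cst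
    | apply: differentiableX; exact: differentiable_coord].
Qed.

Lemma diff_graded_sum v h : 'd graded_sum v h =
  \sum_(j < n) c j * ((I j)%:R * v ord0 ord0 ^+ (I j).-1 * v ord0 ord_max ^+ j * h ord0 ord0
    + v ord0 ord0 ^+ I j * (j%:R * v ord0 ord_max ^+ j.-1) * h ord0 ord_max).
Proof.
rewrite -deriveE; last exact: differentiable_graded_sum.
rewrite graded_sumE; apply: derive_val; apply: is_derive_sum => j.
have -> : term j = cst (c j) * (fun x : 'rV[K]_2 => x ord0 ord0) ^+ I j
    * (fun x : 'rV[K]_2 => x ord0 ord_max) ^+ j.
  by apply/funext => x; rewrite /term /= !fctE.
have d0 := is_derive_coord v h ord0; have d1 := is_derive_coord v h ord_max.
apply: is_derive_eq; rewrite !fctE /= /GRing.scale /=.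
by move: (c j) (v _ _ ^+ I j) (v _ _ ^+ j) => cj xi yj; ring.
Qed.

End Differential.

Lemma coord_le_norm (K : numFieldType) (v : 'rV[K]_2) i : `|v ord0 i| <= `|v|.
Proof.
rewrite -[leRHS]/(mx_norm v) mx_normE -[leLHS]nngE num_le.
exact: (le_bigmax _ _ (ord0, i)).
Qed.

Lemma norm_vec2_0 (K : numFieldType) (y : K) : `|vec2 0 y| <= `|y|.
Proof.
rewrite -[leLHS]/(mx_norm (vec2 0 y)); have [-> //|] := eqVneq (mx_norm (vec2 0 y)) 0.
move=> /mx_norm_neq0[[i j] ->] /=; rewrite !mxE.
by case: ifP; rewrite ?normr0.
Qed.

Lemma near_arc (K : numFieldType) (W : set 'rV[K]_2) w0 w1 (y z : K) :
  (0 < w0)%N -> (0 < w1)%N -> nbhs (0 : 'rV[K]_2) W ->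
  \forall s \near (0 : K), W (vec2 (y * s ^+ w0) (z * s ^+ w1)).
Proof.
move=> w0_gt0 w1_gt0 /nbhs_ballP[e /= e_gt0 eW].
have near_poly (p : {poly K}) : p.[0] = 0 -> \forall s \near (0 : K), `|p.[s]| < e.
  move=> p0; have /cvgrPdist_lt/(_ e e_gt0) := @poly_continuous K p 0.
  by apply: filterS => s; rewrite p0 sub0r normrN.
have n0 : \forall s \near (0 : K), `|(y *: 'X^w0).[s]| < e.
  by apply: near_poly; rewrite hornerZ hornerXn expr0n gtn_eqF ?mulr0.
have n1 : \forall s \near (0 : K), `|(z *: 'X^w1).[s]| < e.
  by apply: near_poly; rewrite hornerZ hornerXn expr0n gtn_eqF ?mulr0.
have : nbhs (0 : K) [set s : K | `|(y *: 'X^w0).[s]| < e /\ `|(z *: 'X^w1).[s]| < e].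
  by near=> s; split; near: s.
apply: filterS => s [s0 s1]; apply: eW; split=> // i j.
rewrite /ball /= !mxE sub0r normrN; rewrite !hornerZ !hornerXn in s0 s1.
by case: ifP.
Unshelve. all: by end_near. Qed.

Lemma near_curve (K : numFieldType) (W : set 'rV[K]_2) w0 w1 (z : K) :
  (0 < w0)%N -> (0 < w1)%N -> nbhs (0 : 'rV[K]_2) W ->
  \forall s \near (0 : K), W (vec2 (s ^+ w0) (z * s ^+ w1)).
Proof.
move=> w0_gt0 w1_gt0 nW; apply: filterS (near_arc 1 z w0_gt0 w1_gt0 nW) => s.
by rewrite mul1r.
Qed.

Lemma lipschitz_const (K : numFieldType) (g : 'rV[K]_2 -> 'rV[K]_2) :
  lipschitz g -> exists2 L : K, 0 <= L & forall x y, `|g x - g y| <= L * `|x - y|.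
Proof.
case=> M [Mreal gM]; exists (`|M| + 1) => [|x y]; first by rewrite addr_ge0.
have : M < `|M| + 1 by rewrite (le_lt_trans (real_ler_norm Mreal)) // ltrDl.
by move=> /gM/(_ (x, y)); apply.
Qed.

Section Curve.
Variables (K : numFieldType) (n w0 w1 d : nat) (I : nat -> nat) (c : nat -> K).
Hypothesis wc : forall j, (j < n)%N -> c j != 0 -> (w0 * I j + w1 * j)%N = d.
Let p := \poly_(j < n) c j.

Lemma graded_sum_curve s z :
  graded_sum n I c (vec2 (s ^+ w0) (z * s ^+ w1)) = s ^+ d * p.[z].
Proof.
rewrite /graded_sum vec2E0 vec2E1 horner_poly mulr_sumr; apply: eq_bigr => j _.
have [->|cj0] := eqVneq (c j) 0; first by rewrite !mul0r mulr0.
rewrite -(wc (ltn_ord j) cj0) exprD !exprM exprMn.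
by move: (c j) (_ ^+ I j) ((_ ^+ w1) ^+ j) (z ^+ j) => ? ? ? ?; ring.
Qed.

Lemma horner_deriv_poly z : p^`().[z] = \sum_(j < n) c j * (j%:R * z ^+ j.-1).
Proof.
rewrite /p poly_def raddf_sum horner_sum; apply: eq_bigr => j _.
by rewrite /= derivZ derivXn hornerZ hornerMn hornerXn mulr_natl.
Qed.

(** Euler's relation w0 x f_x + w1 y f_y = d f eliminates the x-derivative, and
    f is s^d p(z) along the curve. *)
Lemma diff_graded_sum_curve s z h : s != 0 ->
  w0%:R * 'd (graded_sum n I c) (vec2 (s ^+ w0) (z * s ^+ w1)) h =
  s ^+ d * ((d%:R * p.[z] - w1%:R * z * p^`().[z]) * (h ord0 ord0 / s ^+ w0)
    + w0%:R * p^`().[z] * (h ord0 ord_max / s ^+ w1)).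
Proof.
move=> s0; rewrite diff_graded_sum vec2E0 vec2E1.
rewrite horner_deriv_poly horner_poly mulr_sumr.
set A := _ / s ^+ w0; set B := _ / s ^+ w1.
rewrite [X in (X - _) * A]mulr_sumr [X in (_ - X) * A]mulr_sumr -sumrB mulr_suml.
rewrite [X in X * B]mulr_sumr mulr_suml -big_split /= mulr_sumr.
apply: eq_bigr => j _; have [->|cj0] := eqVneq (c j) 0; first by ring.
have e0 k (x : K) : x != 0 -> k%:R * x ^+ k.-1 = k%:R * x ^+ k / x.
  by case: k => [|k] x0; rewrite ?mul0r // exprSr mulrA mulfK.
have ez : j%:R * z ^+ j = j%:R * z ^+ j.-1 * z.
  by case: (j : nat) => [|k]; rewrite ?mul0r // exprSr mulrA.
have sd : s ^+ d = (s ^+ w0) ^+ I j * (s ^+ w1) ^+ j.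
  by rewrite -(wc (ltn_ord j) cj0) exprD !exprM.
have dE : d%:R = w0%:R * (I j)%:R + w1%:R * j%:R :> K.
  by rewrite -(wc (ltn_ord j) cj0) natrD !natrM.
rewrite (e0 _ (s ^+ w0)) ?expf_neq0 // exprMn.
have -> : j%:R * (z * s ^+ w1) ^+ j.-1 = j%:R * z ^+ j.-1 * ((s ^+ w1) ^+ j / s ^+ w1).
  case: (j : nat) => [|k]; first by rewrite !mul0r.
  by rewrite /= exprMn [in RHS]exprSr mulfK ?expf_neq0 // mulrA.
rewrite -/A -/B.
transitivity (c j * (s ^+ d) * (w0%:R * (I j)%:R * z ^+ j * A + w0%:R * (j%:R * z ^+ j.-1) * B)).
  rewrite sd /A /B.
  move: (s ^+ w0) (s ^+ w1) (expf_neq0 w0 s0) (expf_neq0 w1 s0) => x y x0 y0.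
  move: (c j) (x ^+ I j) (y ^+ j) (z ^+ j) (z ^+ j.-1) => c' xi yj zj zj1.
  by field; rewrite x0 y0.
have -> : w0%:R * (I j)%:R = d%:R - w1%:R * j%:R :> K by rewrite dE addrK.
rewrite mulrBl -(mulrA w1%:R) ez.
move: (c j) (s ^+ d) (z ^+ j) (z ^+ j.-1) => c' sd' zj zj1; ring.
Qed.

End Curve.

(** * Restriction to the curves of the weighted action *)

(** The curve s |-> (s^w0, z s^w1) passes through the origin: if all its other
    points were singular, singular points would accumulate at the origin. *)
Lemma isolated_nonsingular (K : numFieldType) (f : 'rV[K]_2 -> K) w0 w1 (z : K) :
  (0 < w0)%N -> (0 < w1)%N -> isolated_singularity f 0 ->
  exists2 s : K, s != 0 & ~ singular_at f (vec2 (s ^+ w0) (z * s ^+ w1)).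
Proof.
move=> w0_gt0 w1_gt0 [_]; rewrite near_withinE => /(near_curve z w0_gt0 w1_gt0) ns.
have : nbhs (0 : K)^' [set s : K | s != 0 /\
    ~ singular_at f (vec2 (s ^+ w0) (z * s ^+ w1))].
  near=> s; have s0 : s != 0 by near: s; exact: nbhs_dnbhs_neq.
  split=> //; have : vec2 (s ^+ w0) (z * s ^+ w1) != 0.
    apply: contra_neq (expf_neq0 w0 s0) => /(congr1 (fun v : 'rV[K]_2 => v ord0 ord0)).
    by rewrite vec2E0 mxE.
  by near: s; exact: nbhs_dnbhs.
by move=> /filter_ex[s [s0 ns0]]; exists s.
Unshelve. all: by end_near. Qed.

(** At a multiple root z the differential vanishes along the whole curve of
    parameter z, by Euler's relation. *)
Lemma isolated_simple_roots (K : numFieldType) n w0 w1 d (I : nat -> nat) (c : nat -> K) z :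
  (0 < w0)%N -> (0 < w1)%N ->
  (forall j, (j < n)%N -> c j != 0 -> (w0 * I j + w1 * j)%N = d) ->
  isolated_singularity (graded_sum n I c) 0 ->
  (\poly_(j < n) c j).[z] = 0 -> (\poly_(j < n) c j)^`().[z] != 0.
Proof.
move=> w0_gt0 w1_gt0 wc iso pz; apply/eqP => p'z.
have [s s0] := isolated_nonsingular z w0_gt0 w1_gt0 iso; apply=> h.
apply/(@mulfI _ w0%:R); first by rewrite pnatr_eq0 -lt0n.
by rewrite (diff_graded_sum_curve wc) // pz p'z !mulr0 subr0 !mul0r addr0 !mulr0.
Qed.

Section FlowAt.
Variables (K : numFieldType) (n w0 w1 d : nat) (I : nat -> nat) (a : nat -> {poly K}).
Variables (F : 'rV[K]_(2 + 1) -> K).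
Hypotheses (K_closed : alg_closed K) (w0_gt0 : (0 < w0)%N) (w01 : (w0 < w1)%N).
Hypothesis d_gt0 : (0 < d)%N.
Hypothesis wa : forall j, (j < n.+2)%N -> a j != 0 -> (w0 * I j + w1 * j)%N = d.
Hypothesis FE : forall t, member F t = graded_sum n.+2 I (fun j => (a j).[t]).
Let Phi := \poly_(j < n.+2) a j.

Lemma specialize_poly t : specialize t Phi = \poly_(j < n.+2) (a j).[t].
Proof.
apply/polyP => i; rewrite coef_map !coef_poly /= /horner_eval.
by case: ifP; rewrite ?horner0.
Qed.

Lemma specialize_deriv_param_poly t : specialize t (deriv_param Phi) = \poly_(j < n.+2) (a j)^`().[t].
Proof.
apply/polyP => i; rewrite coef_map coef_deriv_param !coef_poly /= /horner_eval.
by case: ifP; rewrite ?deriv0 ?horner0.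
Qed.

Lemma derive1_member t v :
  derive1 (fun s => member F s v) t = graded_sum n.+2 I (fun j => (a j)^`().[t]) v.
Proof.
pose q := \sum_(j < n.+2) (v ord0 ord0 ^+ I j * v ord0 ord_max ^+ j) *: a j.
have -> : (fun s => member F s v) = horner q.
  apply/funext => s; rewrite FE /q horner_sum; apply: eq_bigr => j _.
  by rewrite hornerZ -mulrA mulrC.
have dq := is_derive_horner q t 1.
rewrite derive1E derive_val mul1r /q raddf_sum horner_sum; apply: eq_bigr => j _.
by rewrite /= derivZ hornerZ -mulrA mulrC.
Qed.

(** The point of the Lipschitz estimates: at fixed s, changing z moves the point
    (s^w0, z s^w1) in the y direction only, by an amount of order s^w1. *)
Lemma flow_at t (W : set 'rV[K]_2) (v : 'rV[K]_2 -> 'rV[K]_2) :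
  (a n.+1).[t] != 0 -> isolated_singularity (member F t) 0 ->
  open_nbhs (0 : 'rV[K]_2) W -> lipschitz v ->
  (forall x, W x -> derive1 (fun s => member F s x) t = 'd (member F t) x (v x)) ->
  exists A alpha beta, specialize t (deriv_param Phi) =
     A *: specialize t Phi + (alpha *: 'X + beta%:P) * (specialize t Phi)^`().
Proof.
move=> at0 iso /open_nbhs_nbhs nW /lipschitz_const[L L_ge0 Lv] veq.
have w1_gt0 : (0 < w1)%N by apply: leq_trans w01.
pose curve s z : 'rV[K]_2 := vec2 (s ^+ w0) (z * s ^+ w1).
pose V1 s z := v (curve s z) ord0 ord0 / s ^+ w0.
pose V2 s z := v (curve s z) ord0 ord_max / s ^+ w1.
have wat j : (j < n.+2)%N -> (a j).[t] != 0 -> (w0 * I j + w1 * j)%N = d.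
  by move=> jn ajt; apply: wa => //; apply: contra_neq ajt => ->; rewrite horner0.
have wat' j : (j < n.+2)%N -> (a j)^`().[t] != 0 -> (w0 * I j + w1 * j)%N = d.
  by move=> jn ajt; apply: wa => //; apply: contra_neq ajt => ->; rewrite deriv0 horner0.
have w0K : w0%:R != 0 :> K by rewrite pnatr_eq0 -lt0n.
have lip s z z' i : `|v (curve s z) ord0 i - v (curve s z') ord0 i| <=
    L * (`|z - z'| * `|s| ^+ w1).
  have -> : v (curve s z) ord0 i - v (curve s z') ord0 i =
      (v (curve s z) - v (curve s z')) ord0 i by rewrite !mxE.
  apply: le_trans (coord_le_norm _ _) _; apply: le_trans (Lv _ _) _.
  apply: ler_wpM2l => //; rewrite -normrX -normrM mulrBl.
  apply: le_trans (norm_vec2_0 _).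
  rewrite (_ : curve s z - curve s z' = vec2 0 (z * s ^+ w1 - z' * s ^+ w1)) //.
  by apply/rowP => k; rewrite !mxE; case: ifP; rewrite ?subrr.
rewrite specialize_poly specialize_deriv_param_poly.
apply: (@lipschitz_flow K _ _ d w0 w1 (w1 - w0) n V1 V2 L) => //.
- by rewrite subn_gt0.
- by rewrite size_poly_eq.
- move=> c; apply: (isolated_simple_roots w0_gt0 w1_gt0 wat).
  by rewrite -FE.
- move=> z; have nW' := near_curve z w0_gt0 w1_gt0 nW.
  near=> s; have s0 : s != 0 by near: s; exact: nbhs_dnbhs_neq.
  have Ws : W (curve s z) by near: s; exact: nbhs_dnbhs.
  have := veq _ Ws; rewrite derive1_member FE => /(congr1 ( *%R w0%:R)).
  rewrite (graded_sum_curve wat') (diff_graded_sum_curve wat) // mulrCA.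
  by move/(mulfI (expf_neq0 d s0)).
- move=> s z z' s0; rewrite /V1 -mulrBl normrM normfV normrX.
  rewrite ler_pdivrMr ?exprn_gt0 ?normr_gt0 //.
  apply: le_trans (lip _ _ _ _) _.
  have -> : `|s| ^+ w1 = `|s| ^+ (w1 - w0) * `|s| ^+ w0.
    by rewrite -exprD subnK // ltnW.
  move: (`|s| ^+ (w1 - w0)) (`|s| ^+ w0) => x y.
  by have -> : L * (`|z - z'| * (x * y)) = L * x * `|z - z'| * y by ring.
- move=> s z z' s0; rewrite /V2 -mulrBl normrM normfV normrX.
  rewrite ler_pdivrMr ?exprn_gt0 ?normr_gt0 //.
  by rewrite -mulrA.
Unshelve. all: by end_near. Qed.

End FlowAt.

Lemma isolated_axis (K : numFieldType) (f : 'rV[K]_2 -> K) :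
  isolated_singularity f 0 -> exists y : K, ~ singular_at f (vec2 0 y).
Proof.
case=> _; rewrite near_withinE => /(@near_arc _ _ 1 1 0 1 isT isT) ns0.
have ns : \forall s \near (0 : K), vec2 0 s != 0 -> ~ singular_at f (vec2 0 s).
  by apply: filterS ns0 => s; rewrite mul0r mul1r expr1.
have : nbhs (0 : K)^' [set s : K | ~ singular_at f (vec2 0 s)].
  near=> s; have s0 : s != 0 by near: s; exact: nbhs_dnbhs_neq.
  have : vec2 0 s != 0.
    apply: contra_neq s0 => /(congr1 (fun v : 'rV[K]_2 => v ord0 ord_max)).
    by rewrite vec2E1 mxE.
  by near: s; exact: nbhs_dnbhs.
by move=> /filter_ex[s nsing]; exists s.
Unshelve. all: by end_near. Qed.

Section Structure.
Variables (K : numFieldType) (w : 'I_2 -> nat) (U : set K) (F : 'rV[K]_(2 + 1) -> K).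
Hypotheses (w_gt0 : forall i, (0 < w i)%N) (w_lt : (w ord0 < w ord_max)%N).
Hypothesis U_dense : forall p : {poly K}, (forall t, U t -> p.[t] = 0) -> p = 0.
Hypothesis U_neq0 : U !=set0.
Hypothesis polyF : polynomial_function F.
Hypothesis homF : forall t, U t -> exists d, w_homogeneous w d (member F t).
Hypothesis isoF : forall t, U t -> isolated_singularity (member F t) 0.
Let w0 := w ord0.
Let w1 := w ord_max.

(** Two nonzero coefficients are nonzero polynomials in t, so they are both
    nonzero at some common t in U; homogeneity there makes their weights
    equal. Once the degree is fixed, the exponent of y determines that of x. *)
Lemma exists_degree : exists d N (I : nat -> nat) (a : nat -> {poly K}),
  (forall j, a j != 0 -> (w0 * I j + w1 * j)%N = d) /\
  forall t, member F t = graded_sum N I (fun j => (a j).[t]).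
Proof.
have [N [b [bN bE]]] := member_expansion polyF.
have weight t : U t -> exists d, forall i j, (b i j).[t] != 0 -> (w0 * i + w1 * j)%N = d.
  move=> Ut; have [d hd] := homF Ut; exists d => i j bij.
  have /bN/andP[iN jN] : b i j != 0 by apply: contra_neq bij => ->; rewrite horner0.
  exact: (@weight_of_homogeneous K w d N (fun i j => (b i j).[t]) _ (bE t) hd i j iN jN bij).
have [t1 Ut1] := U_neq0.
have [i1 [j1 b1]] : exists i j, b i j != 0.
  apply: contrapT => nob.
  have [s _] := isolated_nonsingular 0 (w_gt0 ord0) (w_gt0 ord_max) (isoF Ut1).
  apply=> h; have -> : member F t1 = cst 0; last by rewrite diff_cst.
  apply/funext => x; rewrite bE big1 // => i _; rewrite big1 // => j _.
  have [->|bij] := eqVneq (b i j) 0; first by rewrite horner0 !mul0r.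
  by case: nob; exists i, j.
pose d := (w0 * i1 + w1 * j1)%N.
have bd i j : b i j != 0 -> (w0 * i + w1 * j)%N = d.
  move=> bij; have : b i j * b i1 j1 != 0 by rewrite mulf_neq0.
  move=> bb; have [t [Ut bbt]] : exists t, U t /\ (b i j * b i1 j1).[t] != 0.
    apply: contrapT => no; move/eqP: bb; apply; apply: U_dense => t Ut.
    by apply/eqP/negPn/negP => bbt; apply: no; exists t.
  have [e be] := weight t Ut.
  by move: bbt; rewrite hornerM mulf_eq0 negb_or => /andP[/be -> /be <-].
pose I j := ((d - w1 * j) %/ w0)%N.
pose a j := if (w0 * I j + w1 * j == d)%N then b (I j) j else 0.
have bI i j : b i j != 0 -> i = I j /\ a j = b i j.
  move=> /bd bij; have -> : i = I j.
    by rewrite /I -bij addnK mulKn // w_gt0.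
  by split=> //; rewrite /a -bij; rewrite /I -bij addnK mulKn ?w_gt0 ?eqxx.
exists d, N, I, a; split=> [j|t].
  by rewrite /a; case: ifP => [/eqP -> //|_]; rewrite eqxx.
apply/funext => x; rewrite bE exchange_big /=; apply: eq_bigr => j _.
have [aj0|aj0] := eqVneq (a j) 0.
  rewrite aj0 horner0 !mul0r big1 // => i _.
  have [->|bij] := eqVneq (b i j) 0; first by rewrite horner0 !mul0r.
  by have [_ aE] := bI _ _ bij; rewrite -aE aj0 eqxx in bij.
have aE : a j = b (I j) j by move: aj0; rewrite /a; case: ifP => //; rewrite eqxx.
have /andP[IN _] : (I j < N)%N && (j < N)%N by apply: bN; rewrite -aE.
rewrite (bigD1 (Ordinal IN)) //= -aE big1 ?addr0 // => i iI.
have [->|bij] := eqVneq (b i j) 0; first by rewrite horner0 !mul0r.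
by have [iE _] := bI _ _ bij; rewrite -val_eqE /= iE eqxx in iI.
Qed.

Hypothesis F0 : forall t, U t -> member F t 0 = 0.

(** If every monomial of f_t had x-exponent at least 2, the y-axis would be
    singular. As w0 < w1, at most one monomial of weight d has x-exponent 0 or
    1, and its y-exponent m is the largest possible; so the same m serves all
    t. *)
Lemma weighted_normal_form : exists d m (I : nat -> nat) (a : nat -> {poly K}),
  [/\ (0 < d)%N, forall j, a j != 0 -> (w0 * I j + w1 * j)%N = d,
      forall t, member F t = graded_sum m.+1 I (fun j => (a j).[t]) &
      forall t, U t -> (a m).[t] != 0].
Proof.
have [d [N [I [a [ad FE]]]]] := exists_degree.
have top t : U t -> exists j, [/\ (j < N)%N, (a j).[t] != 0 & (I j <= 1)%N].
  move=> Ut; apply: contrapT => noj.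
  have [y] := isolated_axis (isoF Ut); apply=> h.
  rewrite FE diff_graded_sum vec2E0 vec2E1 big1 // => j _.
  have [->|aj] := eqVneq (a j).[t] 0; first by rewrite mul0r.
  have : (1 < I j)%N by rewrite ltnNge; apply/negP => Ij; apply: noj; exists j.
  by case: (I j) => [|[|i]] // _; rewrite !expr0n /= !(mulr0, mul0r) addr0 mulr0.
have nz j t : (a j).[t] != 0 -> a j != 0.
  by apply: contra_neq => ->; rewrite horner0.
have [t1 Ut1] := U_neq0; have [m [mN amt Im]] := top t1 Ut1.
have am t : U t -> (a m).[t] != 0.
  move=> Ut; have [j [jN ajt Ij]] := top t Ut.
  suff -> : m = j by [].
  have := ad _ (nz _ _ ajt); have := ad _ (nz _ _ amt); rewrite -/w0 -/w1.
  by have := w_lt; have := w_gt0 ord0; rewrite -/w0 -/w1; nia.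
have am_le j : a j != 0 -> (j <= m)%N.
  move/ad; have := ad _ (nz _ _ amt).
  by have := w_lt; have := w_gt0 ord0; rewrite -/w0 -/w1; nia.
have FE' t : member F t = graded_sum m.+1 I (fun j => (a j).[t]).
  rewrite FE; apply/funext => x; rewrite /graded_sum.
  rewrite [RHS](big_ord_widen N (fun j => (a j).[t] * x ord0 ord0 ^+ I j * x ord0 ord_max ^+ j)) //.
  rewrite [RHS]big_mkcond /=; apply: eq_bigr => j _; rewrite ltnS.
  case: ifP => // jm; have [->|/am_le] := eqVneq (a j) 0; last by rewrite jm.
  by rewrite horner0 !mul0r.
exists d, m, I, a; split=> //.
rewrite lt0n; apply/negP => /eqP d0.
have wm := ad _ (nz _ _ amt); rewrite d0 in wm.
have w0_gt0 : (0 < w0)%N := w_gt0 ord0; have w1_gt0 : (0 < w1)%N := w_gt0 ord_max.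
have I0 : I m = 0%N by nia.
have m0 : m = 0%N by nia.
move: amt I0 (F0 Ut1); rewrite FE' m0 /graded_sum big_ord1 /= => a0 ->.
by rewrite !expr0 !mulr1 => /eqP; apply/negP.
Qed.

End Structure.

(** * Weighted automorphisms of the plane *)

(** The partial sums are constant over the finite sets that contain both
    exponents. *)
Lemma binomial_analytic (K : numFieldType) n (x1 x2 : K) (m1 m2 : {ffun 'I_n -> nat}) :
  analytic_at (fun v : 'rV[K]_n => x1 * \prod_(i < n) v ord0 i ^+ m1 i
                                 + x2 * \prod_(i < n) v ord0 i ^+ m2 i) 0.
Proof.
exists (fun m => x1 * (m == m1)%:R + x2 * (m == m2)%:R).
near=> v; rewrite /has_power_series_sum subr0.
have tf := @summability.totally_filter {ffun (ordinal n) -> nat}.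
apply: cvg_near_cst; exists [fset m1; m2]%fset => // A /= sA.
rewrite /summability.partial_sum.
have [m1A m2A] : m1 \in A /\ m2 \in A.
  by split; apply: (fsubsetP sA); rewrite !inE eqxx ?orbT.
pose g m := (x1 * (m == m1)%:R + x2 * (m == m2)%:R) * \prod_(i < n) v ord0 i ^+ m i.
rewrite -[LHS]/(\sum_(i : A) g (val i)) -(big_seq_fsetE _ A xpredT g) /g.
under eq_bigr => m _ do rewrite mulrDl.
rewrite big_split /=.
have single x m0 : m0 \in A -> \sum_(m <- A) x * (m == m0)%:R *
    \prod_(i < n) v ord0 i ^+ m i = x * \prod_(i < n) v ord0 i ^+ m0 i.
  move=> m0A; rewrite (bigD1_seq m0) ?fset_uniq //= eqxx mulr1 [X in _ + X]big1 ?addr0 // => m.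
  by move=> /negPf ->; rewrite mulr0 mul0r.
by rewrite !single.
Unshelve. all: by end_near. Qed.

Section PlaneAutomorphism.
Variables (K : numFieldType).

Definition triangular (mu be ga : K) k (v : 'rV[K]_2) : 'rV[K]_2 :=
  vec2 (mu * v ord0 ord0) (be * v ord0 ord_max + ga * v ord0 ord0 ^+ k).

Lemma triangular_analytic mu be ga k : analytic_map_at (triangular mu be ga k) 0.
Proof.
pose mono (p q : nat) := [ffun i : 'I_2 => if i == ord0 then p else q].
have monoE p q (v : 'rV[K]_2) : \prod_(i < 2) v ord0 i ^+ mono p q i =
    v ord0 ord0 ^+ p * v ord0 ord_max ^+ q.
  rewrite big_ord_recl big_ord1 !ffunE /=; congr (_ * v _ _ ^+ _).
  exact/val_inj.
move=> j; have [->|j0] := eqVneq j ord0.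
  have := binomial_analytic mu 0 (mono 1 0) (mono 0 0).
  rewrite (_ : (fun v => _) = (fun v => triangular mu be ga k v ord0 ord0)) //.
  by apply/funext => v; rewrite vec2E0 monoE mul0r addr0 expr1 expr0 mulr1.
have -> : j = ord_max by case: j j0 => [[|[|i]] ltj] //= _; exact/val_inj.
have := binomial_analytic be ga (mono 0 1) (mono k 0).
rewrite (_ : (fun v => _) = (fun v => triangular mu be ga k v ord0 ord_max)) //.
by apply/funext => v; rewrite vec2E1 !monoE expr1 !expr0 mulr1 mul1r.
Qed.

Lemma triangular0 mu be ga k : (0 < k)%N -> triangular mu be ga k 0 = 0.
Proof.
move=> k_gt0; apply/rowP => i; rewrite !mxE expr0n gtn_eqF // !mulr0 addr0.
by case: ifP.
Qed.

Lemma triangularK mu be ga k : mu != 0 -> be != 0 ->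
  cancel (triangular mu be ga k) (triangular mu^-1 be^-1 (- (ga / mu ^+ k / be)) k).
Proof.
move=> mu0 be0 v; rewrite [RHS]vec2_eta /triangular vec2E0 vec2E1.
congr vec2; first by rewrite mulKf.
rewrite exprMn; move: (expf_neq0 k mu0); move: (mu ^+ k) => x x0; field.
by rewrite x0 be0.
Qed.

Lemma triangular_bianalytic mu be ga k : mu != 0 -> be != 0 -> (0 < k)%N ->
  bianalytic_germ (triangular mu be ga k).
Proof.
move=> mu0 be0 k_gt0; split; [exact: triangular0 | exact: triangular_analytic |].
exists (triangular mu^-1 be^-1 (- (ga / mu ^+ k / be)) k); split.
- exact: triangular0.
- exact: triangular_analytic.
- by near=> v; exact: triangularK.
near=> v.
(* The other composite: the inverse has the same triangular form, and its own
   inverse is the original map. *)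
have gaE : - (- (ga / mu ^+ k / be) / mu^-1 ^+ k / be^-1) = ga.
  rewrite exprVn; have := expf_neq0 k mu0; move: (mu ^+ k) => x x0; field.
  by rewrite x0 be0.
have := @triangularK mu^-1 be^-1 (- (ga / mu ^+ k / be)) k _ _ v.
by rewrite !invr_eq0 gaE !invrK; apply.
Unshelve. all: by end_near. Qed.

End PlaneAutomorphism.

Lemma horner_inj_off0 (K : numFieldType) (p q : {poly K}) :
  (forall x, x != 0 -> p.[x] = q.[x]) -> p = q.
Proof.
move=> pq; apply: (@mulIf _ 'X); first by rewrite polyX_eq0.
apply: horner_inj => x; rewrite !hornerMX.
by have [->|/pq ->] := eqVneq x 0; rewrite ?mulr0.
Qed.

(** Off the y-axis every point is on a curve of the weighted action, where the
    identity between one-variable polynomials applies; taking a d-th root nu of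
    kap and dilating s by nu absorbs this factor. On the y-axis the identity
    follows because both sides are polynomial in x. *)
Lemma graded_sum_triangular (K : numFieldType) (w0 w1 d n : nat) (I : nat -> nat)
    (c1 c2 : nat -> K) (kap be ga : K) :
  alg_closed K -> (0 < w0)%N -> (w0 < w1)%N -> (0 < d)%N ->
  (forall j, (j < n)%N -> c1 j != 0 -> (w0 * I j + w1 * j)%N = d) ->
  (forall j, (j < n)%N -> c2 j != 0 -> (w0 * I j + w1 * j)%N = d) ->
  kap != 0 -> be != 0 -> (ga = 0 \/ (w0 %| w1)%N) ->
  (forall z, (\poly_(j < n) c1 j).[z] = kap * (\poly_(j < n) c2 j).[be * z + ga]) ->
  analytically_equivalent (graded_sum n I c1) (graded_sum n I c2).
Proof.
move=> K_closed w0_gt0 w01 d_gt0 wc1 wc2 kap0 be0 gaw c12.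
have [nu nuE] : exists nu : K, nu ^+ d = kap := exists_rootn kap K_closed d_gt0.
have nu0 : nu != 0 by apply: contra_neq kap0 => nu0; rewrite -nuE nu0 expr0n gtn_eqF.
pose k := (w1 %/ w0)%N.
have k_gt0 : (0 < k)%N by rewrite divn_gt0 // ltnW.
pose phi := triangular (nu ^+ w0) (be * nu ^+ w1) (ga * nu ^+ w1) k.
have off_axis (v : 'rV[K]_2) : v ord0 ord0 != 0 -> graded_sum n I c1 v = graded_sum n I c2 (phi v).
  move=> x0; have [s sE] : exists s : K, s ^+ w0 = v ord0 ord0 :=
    exists_rootn _ K_closed w0_gt0.
  have s0 : s != 0 by apply: contra_neq x0 => s0; rewrite -sE s0 expr0n gtn_eqF.
  pose z := v ord0 ord_max / s ^+ w1.
  have vE : v = vec2 (s ^+ w0) (z * s ^+ w1).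
    by rewrite sE divfK ?expf_neq0 // -vec2_eta.
  have phiE : phi v = vec2 ((nu * s) ^+ w0) ((be * z + ga) * (nu * s) ^+ w1).
    rewrite vE /phi /triangular vec2E0 vec2E1 exprMn; congr vec2.
    have -> : ga * nu ^+ w1 * (s ^+ w0) ^+ k = ga * nu ^+ w1 * s ^+ w1.
      case: gaw => [->|w01d]; first by rewrite !mul0r.
      by rewrite -exprM mulnC divnK.
    by rewrite exprMn; move: (nu ^+ w1) (s ^+ w1) => x y; ring.
  rewrite phiE vE (graded_sum_curve wc1) (graded_sum_curve wc2) exprMn nuE c12.
  by rewrite mulrCA mulrA.
exists phi; first by apply: triangular_bianalytic; rewrite ?mulf_neq0 ?expf_neq0.
near=> v; pose y := v ord0 ord_max.
pose p1 := \sum_(j < n) (c1 j * y ^+ j) *: 'X^(I j).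
pose p2 := \sum_(j < n) c2 j *: ((nu ^+ w0 *: 'X) ^+ I j
   * ((be * nu ^+ w1 * y)%:P + (ga * nu ^+ w1) *: 'X^k) ^+ j).
have p1E x : p1.[x] = graded_sum n I c1 (vec2 x y).
  rewrite horner_sum; apply: eq_bigr => j _.
  by rewrite hornerZ hornerXn vec2E0 vec2E1 mulrAC.
have p2E x : p2.[x] = graded_sum n I c2 (phi (vec2 x y)).
  rewrite horner_sum; apply: eq_bigr => j _.
  rewrite /phi /triangular !vec2E0 !vec2E1.
  by rewrite hornerZ hornerM !horner_exp hornerD !hornerZ hornerC hornerX hornerXn mulrA.
have p12 : p1 = p2.
  by apply: horner_inj_off0 => x x0; rewrite p1E p2E off_axis // vec2E0.
by rewrite [v]vec2_eta -p1E -p2E p12.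
Unshelve. all: by end_near. Qed.

Theorem strongly_biLipschitz_trivial_rigidity (K : numFieldType) (K_closed : alg_closed K) (w : 'I_2 -> nat)
    (w_gt0 : forall i, (0 < w i)%N) (w_lt : (w ord0 < w ord_max)%N)
    (U : set K) (domU : domain U)
    (F : 'rV[K]_(2 + 1) -> K) (polyF : polynomial_function F)
    (homF : forall t, U t -> exists d : nat, w_homogeneous w d (member F t))
    (isoF : forall t, U t -> isolated_singularity (member F t) 0)
    (trivF : strongly_biLipschitz_trivial U F)
    (t1 t2 : K) (Ut1 : U t1) (Ut2 : U t2) :
  analytically_equivalent (member F t1) (member F t2).
Proof.
have [oU _ U_neq0] := domU.
have U_dense (p : {poly K}) : (forall t, U t -> p.[t] = 0) -> p = 0.
  move=> pU; apply: (@poly_eq0_near K p t1); apply: filterS pU _.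
  exact: open_nbhs_nbhs.
have [W [oW [_ F0] [v [_ v_lip v_eq]]]] := trivF.
have [d [m [I [a [d_gt0 ad FE am]]]]] :=
  weighted_normal_form w_gt0 w_lt U_dense U_neq0 polyF homF isoF F0.
have w0_gt0 := w_gt0 ord0; have w1_gt0 := w_gt0 ord_max.
have ad' t j : (a j).[t] != 0 -> (w ord0 * I j + w ord_max * j)%N = d.
  by move=> ajt; apply: ad; apply: contra_neq ajt => ->; rewrite horner0.
rewrite !FE.
suff [kap [be [ga [kap0 be0 gaw c12]]]] : exists kap be ga : K,
    [/\ kap != 0, be != 0, (ga = 0 \/ (w ord0 %| w ord_max)%N) &
    forall z, (\poly_(j < m.+1) (a j).[t1]).[z] =
      kap * (\poly_(j < m.+1) (a j).[t2]).[be * z + ga]].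
  apply: (@graded_sum_triangular K (w ord0) (w ord_max) d m.+1 I _ _ kap be ga) => // j _.
    exact: ad'.
  exact: ad'.
(* When m = 0 the one-variable polynomials are nonzero constants. *)
case: m FE am => [|n] FE am.
  exists ((a 0%N).[t1] / (a 0%N).[t2]), 1, 0; split; rewrite ?oner_eq0 //.
  - by rewrite mulf_neq0 ?invr_eq0 ?am.
  - by left.
  by move=> z; rewrite !horner_poly !big_ord1 !expr0 !mulr1 divfK ?am.
pose Phi := \poly_(j < n.+2) a j.
have a_top : a n.+1 != 0 by apply: contra_neq (am _ Ut1) => ->; rewrite horner0.
have size_Phi : size Phi = n.+2 by rewrite size_poly_eq.
have [|||kap [be [ga [kap0 be0 ga0 c12]]]] :=
  affine_rigidity K_closed U_dense Ut1 Ut2 size_Phi.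
- by move=> t Ut; rewrite coef_poly ltnSn am.
- move=> t Ut.
  apply: (@flow_at K n _ _ d I a F K_closed w0_gt0 w_lt d_gt0 _ FE t W (v t)) => //.
  + by move=> j _; exact: ad.
  + exact: am.
  + exact: isoF.
  + exact: v_lip.
  + by move=> x Wx; exact: v_eq.
- move=> t c Ut; rewrite specialize_poly.
  apply: (isolated_simple_roots w0_gt0 w1_gt0 (d := d) (I := I)).
    by move=> j _; exact: ad'.
  by rewrite -FE; exact: isoF.
exists kap, be, ga; split=> //; last by move=> z; rewrite -!specialize_poly.
(* Two monomials of weight d with consecutive y-exponents differ by
   y / x^(w1/w0). *)
have [an0|an0] := eqVneq (a n) 0.
  by left; apply: ga0; rewrite coef_poly ltnW.
right; have := ad _ an0; have := ad _ a_top; rewrite mulnS => e1 e2.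
have -> : w ord_max = (w ord0 * (I n - I n.+1))%N by rewrite mulnBr; lia.
exact: dvdn_mulr.
Qed.

Theorem theorem3p2 (R : realType) (w : 'I_2 -> nat)
    (w_gt0 : forall i, (0 < w i)%N) (w_lt : (w ord0 < w ord_max)%N)
    (U : set R[i]) (domU : domain U)
    (F : 'rV[R[i]]_(2 + 1) -> R[i]) (polyF : polynomial_function F)
    (homF : forall t, U t -> exists d : nat, w_homogeneous w d (member F t))
    (isoF : forall t, U t -> isolated_singularity (member F t) 0)
    (trivF : strongly_biLipschitz_trivial U F)
    (t1 t2 : R[i]) (Ut1 : U t1) (Ut2 : U t2) :
  analytically_equivalent (member F t1) (member F t2).
Proof.
have K_closed : alg_closed (R[i]).
  by move=> p /closed_rootP.
exact: (strongly_biLipschitz_trivial_rigidity K_closed w_gt0 w_lt domU polyF homF isoF trivF Ut1 Ut2).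
Qed.
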